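(* Let $F$ be a field of characteristic $\neq2$ and let $a=2i$, $b=2j$ be even natural numbers with $a<b$. Let $U$ be an $F$-vector space of dimension $2b$ and $V_1,\dots,V_4\subset U$ four $b$-dimensional subspaces in general position. Then the following equality holds in $\operatorname{GW}(F)\cong\widetilde{\operatorname{CH}}^{4a(b-a)}(\operatorname{Gr}(2a,2b))$: \[ \sum_{\text{balanced }W}\operatorname{tr}_{F(W)/F}\langle\det\xi_W\rangle=\frac{\binom{2j}{2i}+\binom{j}{i}}{2}\langle1\rangle+\frac{\binom{2j}{2i}-\binom{j}{i}}{2}\langle-1\rangle. \]
   Context: A $2a$-dimensional subspace $W\subset U$ is \emph{balanced} (relative to $V_1,\dots,V_4$) if $\dim(W\cap V_m)=a$ for $m=1,\dots,4$; the sum runs over the closed points $[W]$ of $\operatorname{Gr}(2a,U)$ which are balanced, $F(W)$ being the residue field (over which $W$ is defined). For each $m$, $\Sigma_m=\{W:\dim(W\cap V_m)\geq a\}$ is a smooth Schubert variety whose normal space at $[W]$ is $\operatorname{Hom}(W\cap V_m,U/(V_m+W))$ (dimensions $a$ and $b-a$, both even); the tangent space of $\operatorname{Gr}(2a,U)$ at $[W]$ is $\operatorname{Hom}(W,U/W)$ (dimensions $2a$, $2b-2a$, both even). Each such Hom space $\operatorname{Hom}(A,B)=A^\vee\otimes B$ with $\dim A,\dim B$ even carries the canonical orientation given by the canonical isomorphism $\det(A^\vee\otimes B)\cong(\det A^\vee)^{\otimes\dim B}\otimes(\det B)^{\otimes\dim A}$, exhibiting it as a square. The splitting map $\xi_W:\operatorname{Hom}(W,U/W)\to\bigoplus_{m=1}^4\operatorname{Hom}(W\cap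 V_m,U/(V_m+W))$ (restriction and projection in each summand) is an isomorphism, and $\det\xi_W\in F(W)^\times/(F(W)^\times)^2$ is the square class of its determinant with respect to bases inducing the canonical orientations. $\operatorname{tr}_{E/F}:\operatorname{GW}(E)\to\operatorname{GW}(F)$ is the Scharlau transfer. The identification $\operatorname{GW}(F)\cong\widetilde{\operatorname{CH}}^{4a(b-a)}(\operatorname{Gr}(2a,2b))$ is via the canonical orientation of the Grassmannian. *)

(* Defs.v *)
From HB Require Import structures.
From mathcomp Require Import all_boot all_order all_algebra all_field.
Unset Printing Implicit Defensive.
Import GRing.Theory.
Local Open Scope ring_scope.

(* A form is a Gram matrix (sigma type: size, matrix).                  *)
Definition form (K : fieldType) := {n : nat & 'M[K]_n}.
Definition mkform {K : fieldType} {n} (M : 'M[K]_n) : form K := existT _ n M.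

Definition oplus {K : fieldType} (x y : form K) : form K :=
  mkform (block_mx (projT2 x) 0 0 (projT2 y)).

Fixpoint oplus_seq {K : fieldType} (s : seq (form K)) : form K :=
  match s with
  | [::] => mkform (0 : 'M[K]_0)
  | x :: s' => oplus x (oplus_seq s')
  end.

Definition isometric {K : fieldType} (x y : form K) : Prop :=
  projT1 x = projT1 y /\
  exists P : 'M[K]_(projT1 y, projT1 x),
    \rank P = projT1 y /\ P *m projT2 x *m P^T = projT2 y.

(* [x] = [y] in the Grothendieck-Witt group GW(K) (group completion of the
   monoid of isometry classes of nondegenerate symmetric bilinear forms) *)
Definition gw_eq {K : fieldType} (x y : form K) : Prop :=
  exists (k : nat) (Z : 'M[K]_k), Z^T = Z /\ Z \in unitmx /\
    isometric (oplus x (mkform Z)) (oplus y (mkform Z)).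

Definition pm_form (K : fieldType) (p q : nat) : form K :=
  mkform (diag_mx (\row_(r < p + q) (if (r < p)%N then 1 else -1 : K))).

Definition ftrace {F : fieldType} {E : fieldExtType F} (z : E) : F :=
  \sum_(r < \dim (fullv : {vspace E}))
     coord (vbasis (fullv : {vspace E})) r (z * (vbasis (fullv : {vspace E}))`_r).

Definition transfer1 {F : fieldType} {E : fieldExtType F} (d : E) : form F :=
  mkform (\matrix_(r < \dim (fullv : {vspace E}), s < \dim (fullv : {vspace E}))
    ftrace (d * (vbasis (fullv : {vspace E}))`_r * (vbasis (fullv : {vspace E}))`_s)).

(* Subspaces of U = K^(2b) are row spaces of matrices.                  *)
Definition base_change {F : fieldType} (E : fieldExtType F) {m n}
  (V : 'I_4 -> 'M[F]_(m, n)) : 'I_4 -> 'M[E]_(m, n) :=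
  fun k => map_mx (fun x : F => x%:A) (V k).

Definition balanced {K : fieldType} {a b : nat} (V : 'I_4 -> 'M[K]_(b, 2 * b))
  (W : 'M[K]_(2 * a, 2 * b)) : Prop :=
  \rank W = (2 * a)%N /\ forall m, \rank (W :&: V m)%MS = a.

Definition o4 (k : nat) : 'I_4 := inord k.

(* matrix of the splitting map xi_W, in the tensor bases built from
   bases of the pieces (row-major ordering via mxvec); W has basis the rows
   of W, U/W has basis the rows of C, W cap V_m has basis A_m = P_m W, and
   U/(V_m+W) has basis the rows of D_m, with C = Q_m D_m mod (V_m + W). *)
Definition xi_mx {K : fieldType} {a b : nat}
  (P : 'I_4 -> 'M[K]_(a, 2 * a)) (Q : 'I_4 -> 'M[K]_(2 * b - 2 * a, b - a)) :=
  lin1_mx (fun v : 'rV[K]_(2 * a * (2 * b - 2 * a)) =>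
    row_mx
      (row_mx (mxvec (P (o4 0) *m vec_mx v *m Q (o4 0)))
              (mxvec (P (o4 1) *m vec_mx v *m Q (o4 1))))
      (row_mx (mxvec (P (o4 2) *m vec_mx v *m Q (o4 2)))
              (mxvec (P (o4 3) *m vec_mx v *m Q (o4 3))))).

(* d is (a representative of the square class of) det xi_W, computed in
   bases inducing the canonical orientations *)
Definition xi_det_rep {K : fieldType} {a b : nat} (V : 'I_4 -> 'M[K]_(b, 2 * b))
  (W : 'M[K]_(2 * a, 2 * b)) (d : K) : Prop :=
  exists (C : 'M[K]_(2 * b - 2 * a, 2 * b))
         (A : 'I_4 -> 'M[K]_(a, 2 * b)) (P : 'I_4 -> 'M[K]_(a, 2 * a))
         (D : 'I_4 -> 'M[K]_(b - a, 2 * b))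
         (Q : 'I_4 -> 'M[K]_(2 * b - 2 * a, b - a)),
    [/\ \rank (col_mx W C) = (2 * b)%N,
        forall m, [/\ \rank (A m) = a, (A m <= W)%MS, (A m <= V m)%MS
                    & A m = P m *m W],
        forall m, \rank (col_mx (col_mx (V m) W) (D m)) = (2 * b)%N,
        forall m, (C - Q m *m D m <= V m + W)%MS
      & d = \det (conform_mx (0 : 'M[K]_(2 * a * (2 * b - 2 * a)))
                             (xi_mx P Q))].

(* general position: the V_m are pairwise complementary and the four
   Schubert varieties Sigma_m meet transversally at every balanced point
   (over every finite extension), i.e. xi_W is an isomorphism there *)
Definition gen_pos {F : fieldType} (a b : nat) (V : 'I_4 -> 'M[F]_(b, 2 * b)) : Prop :=
  (forall m m', m != m' -> \rank (col_mx (V m) (V m')) = (2 * b)%N) /\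
  (forall (L : fieldExtType F) (W : 'M[L]_(2 * a, 2 * b)),
     balanced (base_change L V) W ->
     forall d, xi_det_rep (base_change L V) W d -> d != 0).

Definition defined_over {F : fieldType} {E : fieldExtType F} {m n}
  (S : {subfield E}) (W : 'M[E]_(m, n)) : Prop :=
  exists M : 'M[E]_(m, n), (forall r s, M r s \in S) /\ (M == W)%MS.

(* (E_k, W_k)_{k<N} is a complete irredundant list of the closed points [W]
   of Gr(2a, U) which are balanced, with E_k = F(W_k) the residue field:
   - W_k is a balanced E_k-point not defined over a proper subfield of E_k
     (so E_k is its residue field);
   - every balanced point over any finite extension L of F is the image of
     some W_k under an F-embedding E_k -> L;
   - distinct k give distinct closed points. *)
Definition closed_point_system {F : fieldType} (a b : nat)
  (V : 'I_4 -> 'M[F]_(b, 2 * b)) {N : nat} (E : 'I_N -> fieldExtType F)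
  (W : forall k, 'M[E k]_(2 * a, 2 * b)) : Prop :=
  [/\ forall k, balanced (base_change (E k) V) (W k),
      forall k (S : {subfield E k}), defined_over S (W k) -> S = fullv :> {vspace E k},
      forall (L : fieldExtType F) (W' : 'M[L]_(2 * a, 2 * b)),
        balanced (base_change L V) W' ->
        exists k, exists s : 'AHom(E k, L),
          (map_mx (fun x => s x) (W k) == W')%MS
    & forall k k' (s : 'AHom(E k, E k')),
        (map_mx (fun x => s x) (W k) == W k')%MS -> k = k'].

(* Main.v *)
(* The V_m being pairwise complementary, coordinates identify U with H + H so
   that V_1 = H + 0, V_2 = 0 + H, V_3 is the diagonal and V_4 the graph of an
   endomorphism phi of H.  The balanced W are then the A + A with A an
   a-dimensional phi-invariant subspace, and up to squares det xi_W is the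
   determinant of the Sylvester operator v |-> Xv - vZ, where X and Z are phi on
   A and on H / A, i.e. the resultant of their characteristic polynomials.
   General position forces chi = char_poly phi to be separable (when a > 0), so
   the closed points are the orbits of the a-subsets S of its roots, and the
   left-hand side is the form sum_S f_S g_S / prod_(s in S, t notin S) (s - t).
   Multiplying numerator and denominator by the square of the Vandermonde
   determinant of S, the Cauchy-Binet formula identifies it with (-1)^i times the
   a-th exterior power of the residue form (f, g) |-> sum_s f(s) g(s) / chi'(s)
   on polynomials modulo chi.  The latter vanishes on polynomials of degree < j,
   hence is j (<1> + <-1>), and the signature of its 2i-th exterior power is the
   coefficient of t^(2i) in (1 - t^2)^j. *)
Require Import Defs.
From HB Require Import structures.
From mathcomp Require Import all_boot all_order all_algebra all_field.
From mathcomp Require Import fingroup perm ring.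
From Stdlib Require Import Classical.
Import GRing.Theory.
Local Open Scope ring_scope.
Set Implicit Arguments.
Unset Strict Implicit.

(** * Subsets of a given size and the Cauchy-Binet formula *)

(** All residue fields are compared inside one extension [L] that splits chi and receives every
    embedding of every [E k]: over [L], the pairs (closed point, embedding) correspond to the
    a-subsets of the roots. Vectors with coordinates in the [E k] are exhibited whose Gram matrix
    becomes, over [L], that of the exterior power; since F embeds in [L], the equality holds over F.
    Invertibility of this change of basis comes from a dimension count and the nondegeneracy of the
    target. Balanced subspaces are traded for polynomials: once chi is separable, A is the kernel of
    q(phi), where q is the characteristic polynomial of phi on A, so the coefficients of q generate
    the residue field. Separability itself holds because a double root could be given to both
    factors of chi, and the resultant would vanish at the corresponding balanced point. Parity
    enters twice. As a and b - a are even, every change of basis multiplies det xi_W by a square, so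
    explicit bases may be used. As a = 2i, the discriminant of an a-subset is (-1)^i times a square,
    which is where the sign in front of the exterior power comes from. *)

Definition ksubset (n a : nat) : finType := {S : {set 'I_n} | #|S| == a}.

Definition ksubset_elt n a (S : ksubset n a) (c : 'I_a) : 'I_n :=
  enum_val (cast_ord (esym (eqP (valP S))) c).

Lemma ksubset_elt_inj n a (S : ksubset n a) : injective (ksubset_elt S).
Proof. by move=> c c' /enum_val_inj/cast_ord_inj. Qed.

Lemma ksubset_elt_in n a (S : ksubset n a) c : ksubset_elt S c \in val S.
Proof. exact: enum_valP. Qed.

Lemma ksubset_elt_onto n a (S : ksubset n a) s : s \in val S -> exists c, ksubset_elt S c = s.
Proof.
move=> sS; exists (cast_ord (eqP (valP S)) (enum_rank_in sS s)).
by rewrite /ksubset_elt cast_ordK enum_rankK_in.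
Qed.

Lemma card_ksubset n a : #|ksubset n a| = 'C(n, a).
Proof.
by rewrite card_sig -[in RHS](card_ord n) -card_draws; apply: eq_card => S; rewrite !inE.
Qed.

Lemma prod_ksubset_elt (R : comNzRingType) n a (S : ksubset n a) (F : 'I_n -> R) :
  \prod_(c < a) F (ksubset_elt S c) = \prod_(s in val S) F s.
Proof.
rewrite [RHS](reindex_omap (ksubset_elt S) (fun s => [pick c | ksubset_elt S c == s])) /=; last first.
  move=> s /ksubset_elt_onto [c <-]; case: pickP => [c' /eqP <- //|/(_ c)].
  by rewrite eqxx.
apply: eq_bigl => c; rewrite ksubset_elt_in /=; case: pickP => [c' /eqP/ksubset_elt_inj ->|/(_ c)].
  by rewrite eqxx.
by rewrite eqxx.
Qed.

Section CauchyBinet.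

Variable R : comNzRingType.

(** Distributing the product over the rows selects one column index [f i] in each row [i]. *)
Lemma det_mulmx_ffun a n (A : 'M[R]_(a, n)) (B : 'M[R]_(n, a)) :
  \det (A *m B) =
  \sum_(f : {ffun 'I_a -> 'I_n}) (\prod_i A i (f i)) * \det (rowsub f B).
Proof.
rewrite /determinant.
under eq_bigr => s _.
  under eq_bigr => i _ do rewrite mxE.
  rewrite bigA_distr_bigA mulr_sumr; over.
rewrite exchange_big /=; apply: eq_bigr => f _.
rewrite mulr_sumr; apply: eq_bigr => s _.
rewrite big_split /= mulrCA; congr (_ * (_ * _)).
by apply: eq_bigr => i _; rewrite !mxE.
Qed.

Lemma ksubset_elt_perm n a (S : ksubset n a) (f : {ffun 'I_a -> 'I_n}) :
  injective f -> [set f i | i : 'I_a] = val S ->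
  exists s : 'S_a, f = [ffun i => ksubset_elt S (s i)].
Proof.
move=> finj fS.
have ex i : exists c, ksubset_elt S c == f i.
  have /ksubset_elt_onto[c <-] : f i \in val S by rewrite -fS imset_f.
  by exists c.
have uinj : injective (fun i => xchoose (ex i)).
  move=> i i' e; apply: finj.
  by rewrite -(eqP (xchooseP (ex i))) e (eqP (xchooseP (ex i'))).
exists (perm uinj); apply/ffunP => i; rewrite ffunE permE.
by rewrite (eqP (xchooseP (ex i))).
Qed.

Lemma Cauchy_Binet a n (A : 'M[R]_(a, n)) (B : 'M[R]_(n, a)) :
  \det (A *m B) =
  \sum_(S : ksubset n a) \det (colsub (ksubset_elt S) A) * \det (rowsub (ksubset_elt S) B).
Proof.
rewrite det_mulmx_ffun (bigID (fun f : {ffun 'I_a -> 'I_n} => injectiveb f)) /=.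
rewrite [X in _ + X]big1 ?addr0; last first.
  move=> f /injectivePn[i [i' nii' e]].
  rewrite (determinant_alternate nii') ?mulr0 // => k.
  by rewrite !mxE e.
(* Only injective [f] survive, a repeated value giving two equal rows; they are grouped by their
   image, and those with image S differ from the enumeration of S by a permutation. *)
pose im (f : {ffun 'I_a -> 'I_n}) : option (ksubset n a) := insub [set f i | i : 'I_a].
have imE (f : {ffun 'I_a -> 'I_n}) : injective f -> exists2 S, im f = Some S & [set f i | i : 'I_a] = val S.
  move=> finj; rewrite /im; case: insubP => [S _ e|]; first by exists S.
  by rewrite card_imset // card_ord eqxx.
transitivity (\sum_(S : ksubset n a) \sum_(f : {ffun 'I_a -> 'I_n} |
    injectiveb f && (im f == Some S)) \prod_i A i (f i) * \det (rowsub f B)).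
  rewrite (exchange_big_dep (fun f : {ffun 'I_a -> 'I_n} => injectiveb f)) /=; last first.
    by move=> S f _ /andP[].
  apply: eq_bigr => f finj; have [S e _] := imE _ (injectiveP _ finj).
  rewrite (big_pred1 S) // => S' /=; rewrite finj e /=.
  by apply/eqP/eqP => [[->]|->].
apply: eq_bigr => S _; rewrite [X in _ = X * _]/determinant mulr_suml.
have hinj : injective (fun s : 'S_a => [ffun i => ksubset_elt S (s i)]).
  move=> s s' /ffunP e; apply/permP => i; have := e i; rewrite !ffunE.
  exact: ksubset_elt_inj.
rewrite (reindex_omap (fun s : 'S_a => [ffun i => ksubset_elt S (s i)])
  (fun f => [pick s : 'S_a | [ffun i => ksubset_elt S (s i)] == f])) /=; last first.
  move=> f /andP[/injectiveP finj /eqP e].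
  have [S' e1 e2] := imE _ finj; move: e1; rewrite e => -[?]; subst S'.
  have [s ->] := ksubset_elt_perm finj e2; case: pickP => [s' /eqP <- //|/(_ s)].
  by rewrite eqxx.
apply: eq_big => [s|s _].
  have finj : injective [ffun i => ksubset_elt S (s i)].
    by move=> i i'; rewrite !ffunE => /ksubset_elt_inj/perm_inj.
  have -> : injectiveb [ffun i => ksubset_elt S (s i)] by apply/injectiveP.
  have [S' -> e] := imE _ finj.
  have -> : S' = S.
    apply/val_inj; rewrite -e; apply/setP => x; apply/imsetP/idP => [[i _ ->]|].
      by rewrite ffunE ksubset_elt_in.
    by case/ksubset_elt_onto => c <-; exists ((s^-1)%g c); rewrite // ffunE permKV.
  rewrite eqxx /=; case: pickP => [s' /eqP/hinj ->|/(_ s)]; by rewrite eqxx.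
have -> : rowsub [ffun i => ksubset_elt S (s i)] B = row_perm s (rowsub (ksubset_elt S) B).
  by apply/matrixP => x y; rewrite !mxE ffunE.
rewrite [row_perm s _]row_permE det_mulmx det_perm mulrA; congr (_ * _).
rewrite mulrC; congr (_ * _); apply: eq_bigr => i _.
by rewrite !mxE ffunE.
Qed.

(** The matrix of the [a]-th exterior power of [M] in the bases indexed by [a]-subsets. *)
Definition compound a m n (M : 'M[R]_(m, n)) : 'M[R]_(#|ksubset m a|, #|ksubset n a|) :=
  \matrix_(x, y) \det (mxsub (ksubset_elt (enum_val x)) (ksubset_elt (enum_val y)) M).

Lemma compoundM a m n p (M : 'M[R]_(m, n)) (N : 'M[R]_(n, p)) :
  compound a (M *m N) = compound a M *m compound a N.
Proof.
apply/matrixP => x y; rewrite !mxE.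
rewrite (_ : mxsub _ _ _ =
  rowsub (ksubset_elt (enum_val x)) M *m colsub (ksubset_elt (enum_val y)) N); last first.
  by apply/matrixP => u v; rewrite !mxE; apply: eq_bigr => k _; rewrite !mxE.
rewrite Cauchy_Binet (reindex_onto enum_val enum_rank) /=; last first.
  by move=> S _; rewrite enum_rankK.
apply: eq_big => [k|k _]; first by rewrite enum_valK eqxx.
rewrite !mxE; congr (_ * _); congr (\det _); by apply/matrixP => u v; rewrite !mxE.
Qed.

Lemma compound_tr a m n (M : 'M[R]_(m, n)) : compound a M^T = (compound a M)^T.
Proof.
by apply/matrixP => x y; rewrite !mxE -det_tr; congr (\det _); apply/matrixP => u v; rewrite !mxE.
Qed.

Lemma compound_diag a n (d : 'rV[R]_n) :
  compound a (diag_mx d) =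
  diag_mx (\row_x \prod_(s in val (enum_val x : ksubset n a)) d 0 s).
Proof.
apply/matrixP => x y; rewrite !mxE; have [<-|nxy] := eqVneq x y.
  rewrite mulr1n -prod_ksubset_elt.
  transitivity (\det (diag_mx (\row_c d 0 (ksubset_elt (enum_val x) c)))); last first.
    by rewrite det_diag; apply: eq_bigr => c _; rewrite mxE.
  congr (\det _); apply/matrixP => u v; rewrite !mxE.
  by rewrite (inj_eq (@ksubset_elt_inj _ _ _)).
rewrite mulr0n.
have /subsetPn[s sx sy] :
    ~~ (val (enum_val x : ksubset n a) \subset val (enum_val y : ksubset n a)).
  apply: contra nxy => sub; apply/eqP/enum_val_inj/val_inj/eqP.
  rewrite eqEcard sub /=.
  by rewrite (eqP (valP (enum_val x))) (eqP (valP (enum_val y))).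
have [c ec] := ksubset_elt_onto sx.
rewrite (expand_det_row _ c) big1 // => v _; rewrite !mxE ec.
case: eqP => [e|_]; last by rewrite mulr0n mul0r.
by rewrite e ksubset_elt_in in sy.
Qed.

End CauchyBinet.

(** * Bilinear forms *)

Section Forms.

Variable K : fieldType.

Lemma isometric_gw_eq (x y : Defs.form K) : isometric x y -> gw_eq x y.
Proof.
case: x y => [n M] [m M'] [/= e [P [rP eP]]].
exists 0%N, 0; split; first by rewrite trmx0.
split; first by rewrite unitmxE det_mx00 unitr1.
split; first by rewrite /= e.
exists (block_mx P 0 0 1%:M); split=> /=.
  by rewrite rank_diag_block_mx rP mxrank1.
rewrite tr_block_mx !mulmx_block !trmx0 trmx1 /=.
by rewrite !(mulmx0, mul0mx, addr0, add0r, mulmx1, mul1mx) eP.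
Qed.

Lemma oplus_seq_size (I : Type) (s : seq I) (x : I -> Defs.form K) :
  projT1 (oplus_seq [seq x k | k <- s]) = \sum_(k <- s) projT1 (x k).
Proof. by elim: s => [|k s IH]; rewrite ?big_nil // big_cons -IH. Qed.

(** Juxtaposing the [P k] gives [n] vectors of the orthogonal sum, and the summands contribute
    independently to their Gram matrix. *)
Lemma oplus_seq_gram (I : Type) (s : seq I) (x : I -> Defs.form K) n
    (P : forall k, 'M[K]_(n, projT1 (x k))) :
  exists Q : 'M[K]_(n, projT1 (oplus_seq [seq x k | k <- s])),
    Q *m projT2 (oplus_seq [seq x k | k <- s]) *m Q^T =
    \sum_(k <- s) P k *m projT2 (x k) *m (P k)^T.
Proof.
elim: s => [|k s [Q eQ]].
  by exists 0; rewrite big_nil mul0mx mul0mx.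
exists (row_mx (P k) Q); rewrite big_cons -eQ /=.
rewrite tr_row_mx mul_row_block !mulmx0 addr0 add0r.
by rewrite mul_row_col.
Qed.

(** Invertibility is automatic: the sizes agree and the diagonal target has full rank. The
    permutation [f] lists the indices in [s] first. *)
Lemma isometric_pm_form (x : Defs.form K) n p q (P : 'M[K]_(n, projT1 x))
    (s : {pred 'I_n}) :
  projT1 x = n -> n = (p + q)%N -> #|s| = p ->
  P *m projT2 x *m P^T = diag_mx (\row_r (if r \in s then 1 else -1)) ->
  isometric x (pm_form K p q).
Proof.
move=> xn npq sp eP; split; first by rewrite /= xn npq.
pose l := enum s ++ enum (predC s).
have szl : size l = (p + q)%N.
  by rewrite size_cat -!cardE cardC card_ord npq.
pose f (r : 'I_(p + q)) : 'I_n := tnth (in_tuple l) (cast_ord (esym szl) r).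
have finj : injective f.
  have ul : uniq l.
    rewrite cat_uniq !enum_uniq andbT /=; apply/hasPn => y.
    by rewrite !mem_enum inE.
  move=> r r'; rewrite /f !(tnth_nth (f r)) /= => /eqP.
  by rewrite nth_uniq ?szl // => /eqP/val_inj.
have fs r : (f r \in s) = (r < p)%N.
  rewrite /f (tnth_nth (f r)) /= nth_cat -cardE sp; case: ltnP => [ksubset_elt|pr].
    by rewrite -mem_enum mem_nth // -cardE sp.
  have : nth (f r) (enum (predC s)) (r - p) \in enum (predC s).
    rewrite mem_nth // -cardE -(ltn_add2l p) subnKC //.
    by rewrite -{2}sp cardC card_ord npq.
  by rewrite mem_enum inE => /negPf.
pose Q := rowsub f P.
have eQ : Q *m projT2 x *m Q^T = projT2 (pm_form K p q).
  have -> : Q *m projT2 x *m Q^T = mxsub f f (P *m projT2 x *m P^T).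
    apply/matrixP => u v; rewrite !mxE; apply: eq_bigr => k _; rewrite !mxE.
    by congr (_ * _); apply: eq_bigr => l' _; rewrite !mxE.
  rewrite eP; apply/matrixP => u v; rewrite !mxE (inj_eq finj) fs.
  by [].
exists Q; split; last exact: eQ.
apply/eqP; rewrite eqn_leq rank_leq_row /=.
have : \rank (projT2 (pm_form K p q)) = (p + q)%N.
  apply: mxrank_unit; rewrite /= unitmxE det_diag unitfE.
  apply/prodf_neq0 => r _; rewrite mxE.
  by case: ifP => _; rewrite ?oppr_eq0 oner_eq0.
move=> {1}<-; rewrite -eQ.
exact: leq_trans (mxrankM_maxl _ _) (mxrankM_maxl _ _).
Qed.

(** A nondegenerate form with a totally isotropic subspace of half the dimension is hyperbolic when
    2 is invertible. *)
Lemma hyperbolic_diag j (B : 'M[K]_(j + j)) :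
  (2%:R : K) != 0 -> B^T = B -> ulsubmx B = 0 -> B \in unitmx ->
  exists P : 'M[K]_(j + j),
    P *m B *m P^T = diag_mx (\row_r (if (r < j)%N then 1 else -1)).
Proof.
move=> n2 symB B0 uB.
pose U := ursubmx B; pose W := drsubmx B.
have eB : B = block_mx 0 U U^T W.
  rewrite -[LHS]submxK B0; congr block_mx.
  by rewrite -[in LHS]symB -trmx_ursub.
have symW : W^T = W by rewrite trmx_drsub symB.
(* The upper rows (0 U) of the invertible matrix [B] are independent, hence so are the rows of
   [U]. *)
have uU : U \in unitmx.
  rewrite -row_free_unit /row_free -(rank_row_0mx j) -/(row_free _).
  rewrite -[row_mx _ _](@col_mxKu _ j _ _ _ (row_mx U^T W)) -block_mxEv -eB.
  have: row_free B by rewrite row_free_unit.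
  rewrite -{1}[B]vsubmxK => /row_freeP[Bi]; rewrite -[_ *m Bi]vsubmxK.
  rewrite mul_col_mx col_mxKu -[1%:M]vsubmxK => /eq_col_mx[e _].
  apply/row_freeP; exists (lsubmx Bi).
  move/(congr1 lsubmx): e; rewrite -mulmx_lsub => ->.
  by rewrite -[1%:M in LHS]submxK scalar_mx_block !(block_mxKul, block_mxEv) ?col_mxKu ?row_mxKl.
pose h : K := 2%:R^-1.
have hh : h + h = 1 by rewrite -mulr2n -mulr_natl mulfV.
(* Chosen so that [Y *m U] is -W/2; this term and its transpose together cancel the block [W]. *)
pose Y := - h *: (W *m invmx U).
pose P1 := block_mx (invmx U) 0 Y 1%:M.
have e1 : P1 *m B *m P1^T = block_mx 0 1%:M 1%:M 0.
  have YU : Y *m U = - h *: W by rewrite -scalemxAl -mulmxA mulVmx ?mulmx1.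
  rewrite eB /P1 tr_block_mx !mulmx_block trmx0 trmx1.
  rewrite !(mulmx0, mul0mx, addr0, add0r, mulmx1, mul1mx) mulVmx // YU.
  congr block_mx; first by rewrite -trmx_mul mulVmx ?trmx1.
    rewrite -trmx_mul YU linearZ /= symW addrA -scalerDl -opprD hh scaleN1r.
  by rewrite addNr.
(* The vectors x + y/2 and x - y/2 diagonalise the hyperbolic plane spanned by x and y into 1 and
   -1. *)
pose P2 : 'M[K]_(j + j) := block_mx 1%:M h%:M 1%:M (- h)%:M.
exists (P2 *m P1); rewrite trmx_mul mulmxA -(mulmxA P2) -(mulmxA P2) e1.
rewrite /P2 tr_block_mx !mulmx_block !tr_scalar_mx.
rewrite !(mulmx0, mul0mx, addr0, add0r, mulmx1, mul1mx).
have hM : h%:M + h%:M = 1%:M :> 'M[K]_j by rewrite -raddfD hh.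
have NhM : (- h)%:M = - h%:M :> 'M[K]_j by rewrite raddfN.
rewrite NhM -opprD hM subrr addNr.
apply/matrixP => r s; rewrite !mxE; case: splitP => r' er; rewrite !mxE;
  case: splitP => s' es; rewrite !mxE -!val_eqE /= er es.
- by [].
- by rewrite ltn_eqF // ltn_addr.
- by rewrite gtn_eqF ?mulr0n // ltn_addr.
- by rewrite eqn_add2l mulNrn.
Qed.

End Forms.

Lemma signed_sum_ksubset i j :
  \sum_(S : ksubset (j + j) (i + i)) \prod_(s in val S)
     (if (s < j)%N then 1 else -1 : int) = (-1) ^+ i * 'C(j, i)%:R.
Proof.
pose eps (s : 'I_(j + j)) : int := if (s < j)%N then 1 else -1.
have eP : \prod_(s < j + j) ((eps s)%:P * 'X + 1) = (1 - 'X ^+ 2) ^+ j :> {poly int}.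
  rewrite big_split_ord /= (eq_bigr (fun=> 'X + 1)) => [|s _]; last first.
    by rewrite /eps /= ?ltn_ord mul1r.
  rewrite [X in _ * X](eq_bigr (fun=> 1 - 'X)) => [|s _]; last first.
    by rewrite /eps /= ltnNge leq_addr polyCN mulN1r addrC.
  rewrite !prodr_const card_ord -exprMn mulrC; congr (_ ^+ _).
  ring.
have := congr1 (fun p : {poly int} => p`_(i + i)) eP.
have -> : ((1 - 'X^2) ^+ j : {poly int})`_(i + i) = (-1) ^+ i * 'C(j, i)%:R.
  have trm (k : nat) : ((-1) ^+ k * 1 ^+ (j - k) * ('X^2) ^+ k *+ 'C(j, k) : {poly int})`_(i + i)
      = if k == i then (-1) ^+ i * 'C(j, i)%:R else 0.
    rewrite expr1n mulr1 coefMn -exprM -(polyCN 1) -polyC_exp coefCM coefXn.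
    rewrite addnn -muln2 mulnC eqn_mul2l /= eq_sym.
    case: eqP => [->|_]; last by rewrite mulr0 mul0rn.
    by rewrite mulr1 mulr_natr.
  rewrite exprBn coef_sum; under eq_bigr => k _ do rewrite trm.
  case: (ltnP i j.+1) => ij; last first.
    rewrite big1 ?bin_small ?mulr0 // => k _.
    by rewrite ltn_eqF // (leq_trans (ltn_ord k)).
  rewrite (bigD1 (Ordinal ij)) //= eqxx big1 ?addr0 // => k.
  by rewrite -val_eqE /= => /negPf ->.
move=> <-; rewrite bigA_distr coef_sum.
have trm (S : {set 'I_(j + j)}) :
    (\prod_s (if s \in S then (eps s)%:P * 'X else 1) : {poly int})`_(i + i) =
    if #|S| == (i + i)%N then \prod_(s in S) eps s else 0.
  rewrite -big_mkcond /= big_split /= prodr_const -rmorph_prod coefCM coefXn eq_sym.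
  by case: eqP => _; rewrite ?mulr1 ?mulr0.
under [in RHS]eq_bigr => S _ do rewrite trm.
rewrite -big_mkcondr /=. 
rewrite [RHS](reindex_omap (fun S : ksubset (j + j) (i + i) => val S)
  (fun S : {set 'I_(j + j)} => insub S : option (ksubset (j + j) (i + i)))) /=; last first.
  by by move=> S cS; rewrite insubT.
by apply: eq_bigl => S; rewrite (valP S) valK eqxx.
Qed.

(** If [q] subsets have the other sign, then p + q is the number of all subsets, and p - q is the
    signed sum divided by (-1)^i; solving gives both halves, with exact divisions. *)
Lemma card_signed_ksubset i j (p := #|[pred S : ksubset (j + j) (i + i) |
    \prod_(s in val S) (if (s < j)%N then 1 else -1 : int) == (-1) ^+ i]|) :
  p = (('C(2 * j, 2 * i) + 'C(j, i)) %/ 2)%N /\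
  'C(j + j, i + i) = (p + ('C(2 * j, 2 * i) - 'C(j, i)) %/ 2)%N.
Proof.
pose sg (S : ksubset (j + j) (i + i)) : int :=
  \prod_(s in val S) (if (s < j)%N then 1 else -1).
have sgE S : sg S = (-1) ^+ i * (if sg S == (-1) ^+ i then 1 else -1).
  suff : (sg S) ^+ 2 = 1.
    move/eqP; rewrite sqrf_eq1 -signr_odd.
    by case: (odd i) => /orP[] /eqP ->; rewrite ?expr1 ?expr0 ?eqxx.
  by rewrite -prodrXl big1 // => s _; case: ifP.
have := signed_sum_ksubset i j; rewrite -/(sg _).
under eq_bigr => S _ do rewrite -/(sg S) sgE.
have n0 : (-1 : int) ^+ i != 0 by rewrite signr_eq0.
rewrite -mulr_sumr => /(mulfI n0).
rewrite (bigID (fun S => sg S == (-1) ^+ i)) /=.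
rewrite (eq_bigr (fun=> 1)) => [|S ->] //.
rewrite [X in _ + X](eq_bigr (fun=> -1)) => [|S /negPf ->] //.
rewrite !sumr_const -/p -[#|_| in X in _ + X]/(#|predC [pred S | sg S == (-1) ^+ i]|).
set q := #|predC _|; have pq : (p + q)%N = 'C(j + j, i + i).
  by rewrite -(card_ksubset (j + j) (i + i)) -(cardC [pred S | sg S == (-1) ^+ i]).
rewrite mulNrn => /eqP; rewrite subr_eq -natrD Num.Theory.eqr_nat => /eqP e.
rewrite !mul2n -!addnn -pq e.
have -> : ('C(j, i) + q + q + 'C(j, i) = ('C(j, i) + q) * 2)%N by ring.
have -> : ('C(j, i) + q + q - 'C(j, i) = q * 2)%N by rewrite -addnA addKn muln2 addnn.
by rewrite !mulnK.
Qed.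

(** Here and in the next lemma the size is a variable, because it is instantiated by [2 * j], which
    is not convertible to [j + j]. *)
Lemma hyperbolic_diag_cast (K : fieldType) b j (B : 'M[K]_b) :
  b = (j + j)%N -> (2%:R : K) != 0 -> B^T = B -> B \in unitmx ->
  (forall u v : 'I_b, (u < j)%N -> (v < j)%N -> B u v = 0) ->
  exists P : 'M[K]_b,
    P *m B *m P^T = diag_mx (\row_r (if (r < j)%N then 1 else -1)).
Proof.
move=> eb; subst b => n2 symB uB B0; apply: hyperbolic_diag => //.
by apply/matrixP => u v; rewrite !mxE B0 /= ?ltn_ord.
Qed.

Lemma card_signed_ksubset_cast b i j : b = (j + j)%N ->
  let p := #|[pred S : ksubset b (i + i) |
    \prod_(s in val S) (if (s < j)%N then 1 else -1 : int) == (-1) ^+ i]| in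
  p = (('C(2 * j, 2 * i) + 'C(j, i)) %/ 2)%N /\
  #|ksubset b (i + i)| = (p + ('C(2 * j, 2 * i) - 'C(j, i)) %/ 2)%N.
Proof. by move=> eb; subst b; rewrite card_ksubset; apply: card_signed_ksubset. Qed.

(** * Embeddings of finite extensions *)

Lemma irreducible_factor (F : fieldType) (q : {poly F}) :
  (1 < size q)%N -> exists2 r, irreducible_poly r & r %| q.
Proof.
have [n] := ubnP (size q); elim: n q => // n IH q szq q1.
(* Irreducibility is not decidable over an abstract field; a proper factor, if there is one, has
   smaller size. *)
case: (classic (exists r : {poly F}, [/\ (size r != 1)%N, r %| q & ~~ (r %= q)])).
  move=> [r [r1 rq Nrq]].
  have q0 : q != 0 by rewrite -size_poly_gt0 (ltn_trans _ q1).
  have r0 : r != 0 by apply: contraTneq rq => ->; rewrite dvd0p.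
  have ltr : (size r < size q)%N.
    rewrite ltn_neqAle dvdp_leq // andbT; apply: contra Nrq => e.
    by rewrite -dvdp_size_eqp.
  have [||r' irr dv] := IH r; first exact: leq_trans ltr _.
    by rewrite ltn_neqAle eq_sym r1 size_poly_gt0.
  by exists r'; rewrite ?(dvdp_trans dv).
move=> N; exists q => //; split=> // r r1 rq.
by apply: contraT => Nrq; case: N; exists r.
Qed.

Lemma root_extension (F : fieldType) (E : fieldExtType F) (r : {poly E}) :
  irreducible_poly r ->
  exists (L : fieldExtType F) (s : 'AHom(E, L)) (z : L), root (map_poly s r) z.
Proof.
move=> /irredp_FAdjoin[L0 _ [z rz _]].
pose L : fieldExtType F := baseFieldType L0.
pose f : {rmorphism E -> L} := in_alg L0.
have f_lin : linear (locked f).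
  by move=> a u v; rewrite -[in LHS]mulr_algl rmorphD rmorphM -lock mulr_algl.
pose f_linM := GRing.isLinear.Build _ _ _ _ _ f_lin.
pose g : {linear E -> L} := HB.pack (locked f : _ -> _) f_linM.
have gM : ahom_in {:E} (linfun g).
  by apply/ahom_inP; split=> [u v|]; rewrite !lfunE (rmorphM, rmorph1).
exists L, (AHom gM), z; congr (root _ z): rz.
by apply: eq_map_poly => y; rewrite lfunE /= -lock.
Qed.

Lemma splitting_extension (F : fieldType) (E : fieldExtType F) (q : {poly E}) :
  q != 0 ->
  exists (L : fieldExtType F) (s : 'AHom(E, L)) (zs : seq L),
    map_poly s q %= \prod_(z <- zs) ('X - z%:P).
Proof.
have [n] := ubnP (size q); elim: n E q => // n IH E q szq q0.
have [q1|q1] := leqP (size q) 1.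
  exists E, \1%AF, [::]; rewrite big_nil -size_poly_eq1 size_map_poly.
  by rewrite eqn_leq q1 size_poly_gt0.
have [r irr /dvdpP[r' er]] := irreducible_factor q1.
have [L [s [z rz]]] := root_extension irr.
have : root (map_poly s q) z by rewrite er rmorphM /= rootM rz orbT.
case/factor_theorem => p ep.
have p0 : p != 0.
  apply: contraNneq q0 => e; rewrite -(map_poly_eq0 s) ep e mul0r //.
have szp : (size p < n)%N.
  have : size (map_poly s q) = (size p).+1.
    by rewrite ep size_Mmonic ?monicXsubC // size_XsubC addn2.
  by rewrite size_map_poly => e; rewrite -ltnS -e.
have [L' [s' [zs e]]] := IH L p szp p0.
exists L', (s' \o s)%AF, (rcons zs (s' z)).
rewrite -cats1 big_cat big_seq1 /=.
have -> : map_poly (s' \o s)%AF q = map_poly s' (map_poly s q).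
  by rewrite -map_poly_comp; apply: eq_map_poly => x; rewrite comp_lfunE.
by rewrite ep rmorphM /= map_polyXsubC eqp_mulr.
Qed.

Lemma ahom_alg (F : fieldType) (E L : fieldExtType F) (s : 'AHom(E, L)) (c : F) :
  s c%:A = c%:A.
Proof. by rewrite linearZ rmorph1. Qed.

Lemma map_ahom_alg (F : fieldType) (E L : fieldExtType F) (s : 'AHom(E, L))
    (p : {poly F}) :
  map_poly s (map_poly (in_alg E) p) = map_poly (in_alg L) p.
Proof. by rewrite -map_poly_comp; apply: eq_map_poly => x /=; rewrite ahom_alg. Qed.

Section Homs.

Variables (F : fieldType) (E L : fieldExtType F).

(** This and the next lemma reduce a claim about all elements of a residue field to one about a
    generating set: the elements satisfying it form a subfield. *)
Lemma ahom_preim_aspace (s : 'AHom(E, L)) (S : {subfield L}) :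
  exists T : {subfield E}, forall x, (x \in T) = (s x \in S).
Proof.
have mem x : (x \in (s @^-1: S)%VS) = (s x \in S) by rewrite memv_preim.
have T1 : is_aspace (s @^-1: S)%VS.
  rewrite /is_aspace has_algid1 ?mem ?rmorph1 ?mem1v //=.
  apply/prodvP => x y; rewrite !mem => sx sy.
  by rewrite rmorphM memvM.
by exists (ASpace T1).
Qed.

Lemma ahom_eq_aspace (s t : 'AHom(E, L)) :
  exists T : {subfield E}, forall x, (x \in T) = (s x == t x).
Proof.
exists [aspace of lker (ahval s - ahval t)%VF] => x.
by rewrite memv_ker add_lfunE opp_lfunE subr_eq0.
Qed.

Variables (theta : E) (gen : <<1; theta>>%VS = fullv).

Lemma generatorP x : exists p : {poly F}, x = (map_poly (in_alg E) p).[theta].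
Proof. by apply/Fadjoin1_polyP; rewrite gen memvf. Qed.

Lemma ahom_generator_inj (s t : 'AHom(E, L)) : s theta = t theta -> s =1 t.
Proof.
move=> e x; have [p ->] := generatorP x.
by rewrite -!horner_map /= !map_ahom_alg e.
Qed.

(** Two polynomials with the same value at [theta] differ by a multiple of the minimal polynomial,
    which vanishes at [y]; so the image of an element may be computed from an arbitrarily chosen
    polynomial representing it. *)
Lemma adjoin_ahom (m : {poly F}) (y : L) :
  map_poly (in_alg E) m = minPoly 1 theta ->
  root (map_poly (in_alg L) m) y -> exists s : 'AHom(E, L), s theta = y.
Proof.
move=> em ry.
have hornE (M : fieldExtType F) (u : M) (p : {poly F}) :
  fieldExt_horner u p = (map_poly (in_alg M) p).[u] by [].
have ex x : exists p : {poly F}, fieldExt_horner theta p == x.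
  by have [p ->] := generatorP x; exists p; rewrite hornE.
pose f x := fieldExt_horner y (xchoose (ex x)).
have fE p : f (fieldExt_horner theta p) = fieldExt_horner y p.
  have /eqP := xchooseP (ex (fieldExt_horner theta p)).
  rewrite /f; set q := xchoose _ => eq.
  have rt : (map_poly (in_alg E) (q - p)).[theta] = 0.
    by rewrite -hornE rmorphB /= eq subrr.
  suff e : fieldExt_horner y (q - p) = 0.
    by apply/eqP; rewrite -subr_eq0 -e rmorphB.
  apply/eqP; rewrite hornE -rootE.
  have : map_poly (in_alg E) m %| map_poly (in_alg E) (q - p).
    by rewrite em minPoly_dvdp ?alg_polyOver // rootE rt.
  rewrite dvdp_map -(dvdp_map (in_alg L)) => /dvdpP[u ->].
  by rewrite rootM ry orbT.
have pre x : exists p, x = fieldExt_horner theta p.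
  by have [p ->] := generatorP x; exists p.
have f_lin : linear f.
  move=> a u v; have [p ->] := pre u; have [q ->] := pre v.
  by rewrite -linearP !fE linearP.
pose f_linM := GRing.isLinear.Build _ _ _ _ _ f_lin.
pose g : {linear E -> L} := HB.pack f f_linM.
have gM : ahom_in {:E} (linfun g).
  apply/ahom_inP; split=> [u v _ _|]; rewrite !lfunE /=.
    have [p ->] := pre u; have [q ->] := pre v.
    by rewrite -rmorphM !fE rmorphM.
  by have := fE 1; rewrite !rmorph1.
exists (AHom gM); rewrite -[LHS]/(linfun g theta) lfunE /=.
have := fE 'X; rewrite !hornE !map_polyX !hornerX //.
Qed.

End Homs.

Lemma minPoly1_alg (F : fieldType) (E : fieldExtType F) (x : E) :
  exists m : {poly F}, map_poly (in_alg E) m = minPoly 1 x.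
Proof. by have /polyOver1P[m ->] := minPolyOver 1 x; exists m. Qed.

Lemma separable_ahom (F : fieldType) (E L : fieldExtType F) (s : 'AHom(E, L)) x :
  separable_element 1 (s x) -> separable_element 1 x.
Proof. by rewrite /separable_element -[1%VS](aimg1 s) -map_minPoly separable_map. Qed.

(** The matrix [M] of the conjugates of a basis diagonalises multiplication by [z], with eigenvalues
    the conjugates of [z]. There are as many embeddings as the degree, so [M] is square. *)
Lemma ftrace_sum_ahom (F : fieldType) (E L : fieldExtType F)
    (s : 'I_(\dim {:E}) -> 'AHom(E, L)) (theta : E) :
  injective (fun r => s r theta) ->
  forall z : E, (ftrace z)%:A = \sum_r s r z.
Proof.
move=> inj z; set n := \dim {:E} in s inj *.
pose b := vbasis {:E}.
pose M : 'M[L]_n := \matrix_(r, t) s r b`_t.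
have cb x : x = \sum_t coord b t x *: b`_t by rewrite -coord_vbasis ?memvf.
(* A linear relation between the rows is a relation between the embeddings; evaluated at the powers
   of [theta], it is killed by an invertible Vandermonde matrix. *)
have uM : M \in unitmx.
  rewrite -row_free_unit -kermx_eq0; apply/rowV0P => c /sub_kermxP cM.
  have cs x : \sum_r c 0 r * s r x = 0.
    rewrite [x]cb; under eq_bigr => r _.
      rewrite linear_sum mulr_sumr.
      under eq_bigr => t _ do rewrite linearZ /= -scalerAr.
      over.
    rewrite exchange_big big1 // => t _; rewrite -scaler_sumr.
    have /rowP/(_ t) := cM; rewrite !mxE => e.
    rewrite (_ : \sum_r _ = 0) ?scaler0 // -[RHS]e.
    by apply: eq_bigr => r _; rewrite mxE.
  pose V := Vandermonde n (\row_r s r theta).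
  have uV : V \in unitmx.
    rewrite unitmxE unitfE det_Vandermonde; apply/prodf_neq0 => r _.
    apply/prodf_neq0 => r' rr'; rewrite !mxE subr_eq0.
    by apply: contraTneq rr' => /inj ->; rewrite ltnn.
  rewrite -[c](mulmxK (_ : V^T \in unitmx)) ?unitmx_tr //.
  rewrite (_ : c *m V^T = 0) ?mul0mx //.
  apply/rowP => m; rewrite !mxE -[RHS](cs (theta ^+ m)).
  by apply: eq_bigr => r _; rewrite !mxE rmorphXn.
pose T : 'M[L]_n := \matrix_(t, u) (coord b u (z * b`_t))%:A.
have eMT : diag_mx (\row_r s r z) *m M = M *m T^T.
  apply/matrixP => r t; rewrite mul_diag_mx !mxE.
  transitivity (s r (z * b`_t)); first by rewrite rmorphM.
  rewrite {1}(cb (z * b`_t)) linear_sum; apply: eq_bigr => u _.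
  by rewrite !mxE linearZ /= mulr_algr.
have := congr1 (fun A => \tr (A *m invmx M)) eMT.
rewrite mulmxK // mxtrace_mulC mulKmx // mxtrace_tr mxtrace_diag => e.
transitivity (\tr T); last by rewrite -e; apply: eq_bigr => r _; rewrite mxE.
rewrite /ftrace scaler_suml; apply: eq_bigr => r _; by rewrite mxE.
Qed.

(** The minimal polynomial splits in [L] with distinct roots, so there are exactly as many roots as
    the degree, and each embedding is determined by the root to which it sends [theta]. *)
Lemma separable_homs (F : fieldType) (E L : fieldExtType F) (theta : E) (ys : seq L) :
  <<1; theta>>%VS = fullv -> separable_element 1 theta ->
  forall m, map_poly (in_alg E) m = minPoly 1 theta ->
  map_poly (in_alg L) m %| \prod_(y <- ys) ('X - y%:P) ->
  exists s : 'I_(\dim {:E}) -> 'AHom(E, L),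
    injective (fun r => s r theta) /\ forall t : 'AHom(E, L), exists r, t =1 s r.
Proof.
move=> gen sep m em /dvdp_prod_XsubC[b]; set zs := mask b ys => eb.
have szm : size m = (\dim {:E}).+1.
  rewrite -(size_map_poly (in_alg E)) em size_minPoly adjoin_degreeE gen.
  by rewrite dimv1 divn1.
have szs : size zs = \dim {:E}.
  by apply/succn_inj; rewrite -szm -(size_map_poly (in_alg L)) (eqp_size eb) size_prod_XsubC.
have uz : uniq zs.
  rewrite -separable_prod_XsubC -(eqp_separable eb) separable_map.
  by rewrite -(separable_map (in_alg E)) em.
have rz z : (z \in zs) = root (map_poly (in_alg L) m) z.
  by rewrite (eqp_root eb) root_prod_XsubC.
have ex (r : 'I_(\dim {:E})) : exists s : 'AHom(E, L), s theta == zs`_r.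
  have [|s e] := @adjoin_ahom _ _ L _ gen m zs`_r em.
    by rewrite -rz mem_nth // szs.
  by exists s; rewrite e.
exists (fun r => xchoose (ex r)); split=> [r r'|t].
  rewrite (eqP (xchooseP (ex r))) (eqP (xchooseP (ex r'))) => /eqP.
  by rewrite nth_uniq ?szs // => /eqP/val_inj.
have : t theta \in zs.
  rewrite rz -(map_ahom_alg t) em rootE horner_map /=.
  by rewrite minPolyxx rmorph0.
move=> tz; have lt : (index (t theta) zs < \dim {:E})%N by rewrite -szs index_mem.
exists (Ordinal lt); apply: (ahom_generator_inj gen).
by rewrite (eqP (xchooseP (ex (Ordinal lt)))) nth_index.
Qed.

(** * Traces, Lagrange interpolation and discriminants *)

Lemma splitting_field (F : fieldType) (p : {poly F}) : p != 0 ->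
  exists (L : fieldExtType F) (zs : seq L),
    map_poly (in_alg L) p %= \prod_(z <- zs) ('X - z%:P).
Proof.
move=> p0; have [L [s [zs e]]] := @splitting_extension F F^o p p0.
exists L, zs; rewrite -(map_ahom_alg s); congr (_ %= _): e.
rewrite (_ : map_poly (in_alg F^o) p = p) //.
by apply: map_poly_id => x _; apply: mulr1.
Qed.

Lemma ftraceD (F : fieldType) (E : fieldExtType F) : {morph @ftrace F E : x y / x + y}.
Proof.
by move=> x y; rewrite -big_split /=; apply: eq_bigr => r _; rewrite mulrDl linearD.
Qed.

Lemma ftraceZ (F : fieldType) (E : fieldExtType F) c (x : E) :
  ftrace (c *: x) = c * ftrace x.
Proof.
by rewrite mulr_sumr; apply: eq_bigr => r _; rewrite -scalerAl linearZ.
Qed.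

Lemma ftrace_sum (F : fieldType) (E : fieldExtType F) n (u : 'I_n -> E) :
  ftrace (\sum_r u r) = \sum_r ftrace (u r).
Proof.
apply: (big_morph _ (@ftraceD F E)).
by rewrite -[0](scale0r 0) ftraceZ mul0r.
Qed.

Lemma transfer1_gram (F : fieldType) (E : fieldExtType F) (d : E) n (u : 'I_n -> E)
    (P := \matrix_(x, r) coord (vbasis {:E}) r (u x) : 'M[F]_(n, \dim {:E})) x y :
  (P *m projT2 (transfer1 d) *m P^T) x y = ftrace (d * u x * u y).
Proof.
pose b := vbasis {:E}.
have cb v : v = \sum_t coord b t v *: b`_t by rewrite -coord_vbasis ?memvf.
rewrite [in RHS](cb (u y)) mulr_sumr ftrace_sum mxE; apply: eq_bigr => s _.
rewrite -scalerAr ftraceZ mulrC !mxE; congr (_ * _).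
rewrite [in RHS](cb (u x)) mulr_sumr mulr_suml ftrace_sum; apply: eq_bigr => r _.
by rewrite -scalerAr -scalerAl ftraceZ !mxE.
Qed.

(** Each of the i(2i - 1) unordered pairs contributes minus the square of its difference, and i(2i -
    1) has the parity of i. *)
Lemma disc_sign (R : comNzRingType) i (y : 'I_(i + i) -> R) :
  \prod_c \prod_(c' | c' != c) (y c - y c') =
  (-1) ^+ i * (\prod_(c < i + i) \prod_(c' < i + i | (c < c')%N) (y c' - y c)) ^+ 2.
Proof.
have sg : \prod_(c < i + i) \prod_(c' < i + i | (c < c')%N) (-1) = (-1) ^+ i :> R.
  have -> : \prod_(c < i + i) \prod_(c' < i + i | (c < c')%N) (-1) =
            \prod_(c < i + i) (-1) ^+ c :> R.
    rewrite (reindex_inj rev_ord_inj); apply: eq_bigr => c _ /=.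
    rewrite prodr_const; congr (_ ^+ _).
    rewrite -[RHS]card_ord -sum1_card -sum1_card /=.
    rewrite (big_ord_widen (i + i) (fun=> 1%N)) ?(ltnW (ltn_ord c)) //.
    rewrite (reindex_inj rev_ord_inj) /=; apply: eq_bigl => c' /=.
    have := ltn_ord c; have := ltn_ord c'; rewrite unfold_in /=.
    move: (nat_of_ord c) (nat_of_ord c') => u v vi ui.
    rewrite -[LHS]/(i + i - u.+1 < i + i - v.+1)%N.
    by rewrite ltn_sub2lE //.
  elim: i {y} => [|i IH]; first by rewrite big_ord0.
  have e1 : (-1) ^+ (i + i) = 1 :> R by rewrite addnn -signr_odd odd_double.
  by rewrite addnS addSn !big_ord_recr /= IH !exprS e1 !mulr1 mulrC.
have split c : \prod_(c' | c' != c) (y c - y c') =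
    (\prod_(c' < i + i | (c < c')%N) -1) *
    (\prod_(c' < i + i | (c < c')%N) (y c' - y c)) *
    \prod_(c' < i + i | (c' < c)%N) (y c - y c').
  rewrite (bigID (fun c' : 'I_ _ => (c < c')%N)) /= -big_split /=; congr (_ * _).
    apply: eq_big => [c'|c' _]; last by rewrite mulN1r opprB.
    by rewrite -val_eqE neq_ltn; case: ltngtP.
  apply: eq_bigl => c'; rewrite -val_eqE neq_ltn -leqNgt /=.
  by case: ltngtP.
rewrite (eq_bigr _ (fun c _ => split c)) !big_split /= sg -mulrA; congr (_ * _).
rewrite expr2; congr (_ * _).
rewrite (exchange_big_dep xpredT) //=.
Qed.

Section Lagrange.

Variables (K : fieldType) (b : nat) (z : 'I_b -> K).
Hypothesis z_inj : injective z.

(** The value at [z s] of the derivative of the monic polynomial with roots [z]. *)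
Definition node_weight s := \prod_(t | t != s) (z s - z t).

Lemma node_weight_neq0 s : node_weight s != 0.
Proof.
by apply/prodf_neq0 => t; rewrite subr_eq0 (inj_eq z_inj) eq_sym.
Qed.

(** The basis polynomials [l s] are monic of degree b - 1, so the top coefficient of the
    interpolation formula is the sum of its weights. *)
Lemma lagrange_top_coef (p : {poly K}) : (size p <= b)%N ->
  p`_b.-1 = \sum_s p.[z s] / node_weight s.
Proof.
move=> szp.
pose l s := \prod_(t | t != s) ('X - (z t)%:P).
have szl s : size (l s) = b.
  rewrite /l -big_enum size_prod_XsubC /= -cardE cardC1 card_ord.
  by rewrite prednK // (leq_trans _ (ltn_ord s)).
have lz s t : (l s).[z t] = if t == s then node_weight s else 0.
  rewrite /l horner_prod; case: eqP => [->|/eqP ts].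
    by apply: eq_bigr => u _; rewrite hornerXsubC.
  by rewrite (bigD1 t) //= hornerXsubC subrr mul0r.
have ep : p = \sum_s (p.[z s] / node_weight s) *: l s.
  (* The difference [r] has size at most [b] and vanishes at [b] distinct points. *)
  apply/eqP; rewrite -subr_eq0; set r := _ - _.
  apply: contraT => r0; have: (b < size r)%N; last first.
    rewrite ltnNge (leq_trans (size_polyD _ _)) // geq_max szp size_polyN.
    apply: (leq_trans (size_sum _ _ _)); apply/bigmax_leqP => s _.
    by rewrite (leq_trans (size_scale_leq _ _)) ?szl.
  rewrite -{1}(card_ord b) cardE -(size_map z); apply: max_poly_roots => //.
    apply/allP => _ /mapP[s _ ->]; rewrite rootE hornerD hornerN horner_sum.
    rewrite (bigD1 s) //= hornerZ lz eqxx divfK ?node_weight_neq0 // big1 ?addr0 ?subrr //.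
    by move=> t ts; rewrite hornerZ lz eq_sym (negPf ts) mulr0.
  by rewrite map_inj_uniq ?enum_uniq.
rewrite {1}ep coef_sum; apply: eq_bigr => s _; rewrite coefZ.
have -> : (l s)`_b.-1 = lead_coef (l s) by rewrite /lead_coef szl.
by rewrite lead_coef_prod_XsubC mulr1.
Qed.

(** Reduction modulo [q] in monomial bases. Its entries lie in the field of coefficients of [q],
    unlike a Vandermonde matrix in the roots, so its minors give elements of the residue field. *)
Definition rem_mx (R : fieldType) n m (q : {poly R}) : 'M[R]_(n, m) :=
  \matrix_(u, c) (('X^u %% q)`_c).

Definition poly_of_set (S : {set 'I_b}) := \prod_(s in S) ('X - (z s)%:P).

Lemma size_poly_of_set S : size (poly_of_set S) = #|S|.+1.
Proof. by rewrite /poly_of_set -big_enum size_prod_XsubC -cardE. Qed.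

Lemma monic_poly_of_set S : poly_of_set S \is monic.
Proof. exact: monic_prod_XsubC. Qed.

Lemma root_poly_of_set S s : root (poly_of_set S) (z s) = (s \in S).
Proof.
rewrite /poly_of_set -big_enum -(big_map z xpredT (fun x => 'X - x%:P)).
by rewrite root_prod_XsubC mem_map // mem_enum.
Qed.

Lemma poly_of_set_inj : injective poly_of_set.
Proof.
by move=> S S' e; apply/setP => s; rewrite -!root_poly_of_set e.
Qed.

Lemma dvdp_poly_of_set (q : {poly K}) : q \is monic ->
  q %| \prod_s ('X - (z s)%:P) -> exists S, q = poly_of_set S.
Proof.
move=> mq /dvdp_prod_XsubC[m e].
exists [set s in mask m (index_enum 'I_b)]; apply/eqP; rewrite -eqp_monic //; last first.
  exact: monic_poly_of_set.
congr (_ %= _): e; rewrite big_uniq ?mask_uniq ?index_enum_uniq //=.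
by apply: eq_bigl => s; rewrite inE.
Qed.

(** A power of the variable and its remainder take the same values at the roots of the divisor. *)
Lemma rem_mx_vandermonde a (S : ksubset b a) n :
  rem_mx n a (poly_of_set (val S)) *m Vandermonde a (\row_c z (ksubset_elt S c)) =
  \matrix_(u, c) z (ksubset_elt S c) ^+ u.
Proof.
apply/matrixP => u c; rewrite !mxE.
have szm : (size ('X^u %% poly_of_set (val S))%R <= a)%N.
  rewrite -ltnS -[in X in (_ < X)%N](eqP (valP S)) -size_poly_of_set ltn_modp.
  by rewrite monic_neq0 ?monic_poly_of_set.
have rt : root (poly_of_set (val S)) (z (ksubset_elt S c)) by rewrite root_poly_of_set ksubset_elt_in.
rewrite -[in RHS]hornerXn [in RHS](divp_eq 'X^u (poly_of_set (val S))).
rewrite hornerD hornerM (rootP rt) mulr0 add0r (horner_coef_wide _ szm).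
by apply: eq_bigr => v _; rewrite !mxE.
Qed.

(** The resultant of the factors with roots in [S] and in its complement. *)
Definition set_res (S : {set 'I_b}) := \prod_(s in S) \prod_(t in ~: S) (z s - z t).

Lemma set_res_neq0 S : set_res S != 0.
Proof.
apply/prodf_neq0 => s sS; apply/prodf_neq0 => t; rewrite inE subr_eq0 (inj_eq z_inj).
by apply: contraNneq => <-.
Qed.

(** The differences inside S form a discriminant, to which [disc_sign] applies; those between S and
    its complement form the resultant. *)
Lemma prod_node_weight i (S : ksubset b (i + i)) :
  \prod_(s in val S) node_weight s =
  (-1) ^+ i * (\det (Vandermonde (i + i) (\row_c z (ksubset_elt S c)))) ^+ 2 * set_res (val S).
Proof.
have e s : s \in val S ->
    node_weight s = (\prod_(t in val S | t != s) (z s - z t)) * \prod_(t in ~: val S) (z s - z t).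
  move=> sS; rewrite /node_weight (bigID (fun t => t \in val S)) /=; congr (_ * _).
    by apply: eq_bigl => t; rewrite andbC.
  apply: eq_bigl => t; rewrite inE; case: (boolP (t \in val S)); rewrite ?andbF ?andbT //.
  by apply: contraNneq => ->.
rewrite (eq_bigr _ e) big_split /=; congr (_ * _).
rewrite -(prod_ksubset_elt S (fun s => \prod_(t in val S | t != s) (z s - z t))).
rewrite det_Vandermonde; under [in RHS]eq_bigr => c _.
  under eq_bigr => c' _ do rewrite !mxE.
  over.
rewrite -(disc_sign (fun c => z (ksubset_elt S c))); apply: eq_bigr => c _.
rewrite big_mkcondr -(prod_ksubset_elt S (fun t => if t != ksubset_elt S c then z (ksubset_elt S c) - z t else 1)).
rewrite [RHS]big_mkcond; apply: eq_bigr => c' _.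
by rewrite (inj_eq (@ksubset_elt_inj _ _ S)).
Qed.

End Lagrange.

Section ResidueForm.

Variables (F : fieldType) (b : nat) (chi : {poly F}).
Hypotheses (chi_monic : chi \is monic) (chi_size : size chi = b.+1).

(* Gram matrix, in the monomial basis, of the residue form: by Lagrange
   interpolation the top coefficient of [p %% chi] is the sum of [p(s) / chi'(s)]
   over the roots [s] of [chi]. *)
Definition residue_mx : 'M[F]_b := \matrix_(u, v) (('X^(u + v) %% chi)`_b.-1).

Lemma residue_mx_sym : residue_mx^T = residue_mx.
Proof. by apply/matrixP => u v; rewrite !mxE addnC. Qed.

Variables (L : fieldExtType F) (z : 'I_b -> L).
Hypotheses (z_inj : injective z)
  (chi_split : map_poly (in_alg L) chi = \prod_s ('X - (z s)%:P)).

Definition eval_mx := \matrix_(u < b, s < b) z s ^+ u.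

Lemma map_residue_mx :
  map_mx (in_alg L) residue_mx =
  eval_mx *m diag_mx (\row_s (node_weight z s)^-1) *m eval_mx^T.
Proof.
apply/matrixP => u v; rewrite !mxE -[LHS]coef_map map_modp map_polyXn.
rewrite (lagrange_top_coef z_inj); last first.
  rewrite -ltnS -chi_size -(size_map_poly (in_alg L)) ltn_modp map_poly_eq0.
  exact: monic_neq0.
apply: eq_bigr => s _; rewrite mul_mx_diag !mxE.
have rt : root (map_poly (in_alg L) chi) (z s).
  by rewrite chi_split rootE horner_prod (bigD1 s) //= hornerXsubC subrr mul0r.
have -> : ('X^(u + v) %% map_poly (in_alg L) chi).[z s] = z s ^+ (u + v).
  rewrite -[in RHS]hornerXn [in RHS](divp_eq 'X^(u + v) (map_poly (in_alg L) chi)).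
  by rewrite hornerD hornerM (rootP rt) mulr0 add0r.
by rewrite exprD mulrAC.
Qed.

Lemma residue_mx_unit : residue_mx \in unitmx.
Proof.
rewrite -(map_unitmx (in_alg L)) map_residue_mx !unitmx_mul unitmx_tr andbAC andbb.
have -> : eval_mx = Vandermonde b (\row_s z s).
  by apply/matrixP => u s; rewrite !mxE.
rewrite !unitmxE !unitfE det_diag det_Vandermonde; apply/andP; split.
  apply/prodf_neq0 => s _; apply/prodf_neq0 => t st; rewrite !mxE subr_eq0.
  by apply: contraTneq st => /z_inj ->; rewrite ltnn.
by apply/prodf_neq0 => s _; rewrite mxE invr_eq0 node_weight_neq0.
Qed.

(** By Cauchy-Binet the left-hand side is a sum over S of products of two minors of [eval_mx],
    divided by the node weights of S. Each minor is one of [rem_mx] times the Vandermonde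
    determinant of S, whose square cancels against the node weights. *)
Lemma compound_residue_mx i x y :
  (-1) ^+ i * (compound (i + i) residue_mx x y)%:A =
  \sum_(S : ksubset b (i + i)) (set_res z (val S))^-1 *
    \det (rowsub (ksubset_elt (enum_val x)) (rem_mx b (i + i) (poly_of_set z (val S)))) *
    \det (rowsub (ksubset_elt (enum_val y)) (rem_mx b (i + i) (poly_of_set z (val S)))).
Proof.
have detE (S : ksubset b (i + i)) x' :
    \det (mxsub (ksubset_elt (enum_val x')) (ksubset_elt S) eval_mx) =
    \det (rowsub (ksubset_elt (enum_val x')) (rem_mx b (i + i) (poly_of_set z (val S)))) *
    \det (Vandermonde (i + i) (\row_c z (ksubset_elt S c))).
  rewrite -det_mulmx; congr (\det _).
  rewrite mul_rowsub_mx rem_mx_vandermonde //.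
  by apply/matrixP => u c; rewrite !mxE.
have -> : (compound (i + i) residue_mx x y)%:A =
          compound (i + i) (map_mx (in_alg L) residue_mx) x y.
  rewrite !mxE -[LHS]/(in_alg L _) -det_map_mx; congr (\det _).
  by apply/matrixP => u v; rewrite !mxE.
rewrite map_residue_mx !compoundM compound_tr compound_diag mxE mulr_sumr.
rewrite (reindex_onto enum_rank enum_val) /=; last by move=> u _; rewrite enum_valK.
apply: eq_big => [S|S _]; first by rewrite enum_rankK eqxx.
rewrite mul_mx_diag !mxE enum_rankK !detE.
under eq_bigr => s _ do rewrite mxE.
rewrite prodfV (prod_node_weight z S).
set V := \det (Vandermonde _ _); set P := \det _; set Q := \det _.
have V0 : V != 0.
  rewrite /V det_Vandermonde; apply/prodf_neq0 => s _.
  apply/prodf_neq0 => t st; rewrite !mxE subr_eq0 (inj_eq z_inj) (inj_eq (@ksubset_elt_inj _ _ S)).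
  by apply: contraTneq st => ->; rewrite ltnn.
have r0 := set_res_neq0 z_inj (val S).
have e0 : (-1 : L) ^+ i != 0 by rewrite signr_eq0.
by field; rewrite V0 r0 e0.
Qed.

End ResidueForm.

(** * The form attached to the factors of a separable polynomial *)

Section FactorAlgebra.

Variables (F : fieldType) (i b : nat) (chi : {poly F}).
Local Notation a := (i + i)%N.
Hypotheses (chi_monic : chi \is monic) (chi_size : size chi = b.+1)
  (chi_sep : separable_poly chi).
Variables (N : nat) (E : 'I_N -> fieldExtType F) (q : forall k, {poly E k}).
Arguments q : clear implicits.
(** In the application [q k] is the characteristic polynomial of phi on the subspace defining [W k].
    The last three hypotheses transcribe the minimality of the residue fields and the completeness
    and irredundancy of the list of closed points. *)
Hypotheses
  (q_monic : forall k, q k \is monic)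
  (q_size : forall k, size (q k) = a.+1)
  (q_dvd : forall k, q k %| map_poly (in_alg (E k)) chi)
  (q_gen : forall k (S : {subfield E k}),
     q k \is a polyOver S -> S = fullv :> {vspace E k})
  (q_all : forall (L : fieldExtType F) (p : {poly L}) (zs : seq L),
     map_poly (in_alg L) chi = \prod_(z <- zs) ('X - z%:P) ->
     p \is monic -> size p = a.+1 -> p %| map_poly (in_alg L) chi ->
     exists k, exists s : 'AHom(E k, L), map_poly s (q k) = p)
  (q_distinct : forall k k' (s : 'AHom(E k, E k')),
     map_poly s (q k) = q k' -> k = k').

Lemma map_chi_monic (L : fieldExtType F) : map_poly (in_alg L) chi \is monic.
Proof. by exact: monic_map. Qed.

(** The coefficients of an embedded [q k] lie in the separable extension generated by the roots of
    chi, and they generate the image of [E k]. *)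
Lemma factor_field_separable k (x : E k) : separable_element 1 x.
Proof.
have [|L [s [zs]]] := @splitting_extension F (E k) (map_poly (in_alg (E k)) chi).
  by rewrite monic_neq0 ?map_chi_monic.
rewrite map_ahom_alg => e; apply: (separable_ahom (s := s)).
have sepz : separable 1 <<1 & zs>>%VS.
  apply: separable_Fadjoin_seq; apply/allP => z zz.
  apply/separable_elementP; exists (map_poly (in_alg L) chi); split.
  - exact: alg_polyOver.
  - by rewrite (eqp_root e) root_prod_XsubC.
  - by rewrite separable_map.
apply: (separableP sepz); have [T memT] := ahom_preim_aspace s <<1 & zs>>%AS.
suff T1 : q k \is a polyOver T by rewrite -memT (q_gen T1) memvf.
have sq : map_poly s (q k) %| \prod_(z <- zs) ('X - z%:P).
  by rewrite -(eqp_dvdr _ e) -(map_ahom_alg s) dvdp_map q_dvd.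
have [m em] := dvdp_prod_XsubC sq.
have {}em : map_poly s (q k) = \prod_(z <- mask m zs) ('X - z%:P).
  by apply/eqP; rewrite -eqp_monic ?monic_prod_XsubC ?monic_map ?q_monic.
apply/polyOverP => c; rewrite memT -coef_map em; apply/polyOverP.
rewrite big_seq; apply: rpred_prod => z /mem_mask zz.
by rewrite polyOverXsubC seqv_sub_adjoin.
Qed.

Lemma factor_field_generator k :
  exists theta : E k, <<1; theta>>%VS = fullv /\ separable_element 1 theta.
Proof.
exists (separable_generator 1 {:E k}); split; last exact: factor_field_separable.
rewrite -eq_adjoin_separable_generator ?subvf //.
by apply/separableP => y _; apply: factor_field_separable.
Qed.

(** The image of [s] is generated by the coefficients of the common polynomial, hence lies in the
    image of [s'], and [s] factors through [s']. *)
Lemma factor_homs_distinct (L : fieldExtType F) k k' (s : 'AHom(E k, L))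
    (s' : 'AHom(E k', L)) :
  map_poly s (q k) = map_poly s' (q k') -> exists t : 'AHom(E k, E k'), s =1 s' \o t.
Proof.
move=> e; have [th [gen _]] := factor_field_generator k.
have [T memT] := ahom_preim_aspace s [aspace of limg s'].
have sT x : exists y, s x = s' y.
  have : x \in T.
    rewrite (@q_gen k T) ?memvf //; apply/polyOverP => c.
    by rewrite memT -coef_map e coef_map memv_img ?memvf.
  by rewrite memT => /memv_imgP[y _ ->]; exists y.
have [y ey] := sT th; have [m em] := minPoly1_alg th.
have [|t et] := adjoin_ahom gen (y := y) em.
  rewrite -(fmorph_root s') map_ahom_alg /= -ey -(map_ahom_alg s) em.
  by rewrite (fmorph_root s) root_minPoly.
exists t => x /=; rewrite -[RHS](comp_lfunE (ahval s') (ahval t)).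
apply: (ahom_generator_inj gen (t := (s' \o t)%AF)).
by rewrite /= comp_lfunE et.
Qed.

Lemma factor_hom_unique (L : fieldExtType F) k (s s' : 'AHom(E k, L)) :
  map_poly s (q k) = map_poly s' (q k) -> s =1 s'.
Proof.
move=> e x; have [T memT] := ahom_eq_aspace s s'.
apply/eqP; rewrite -memT (@q_gen k T) ?memvf //; apply/polyOverP => c.
by rewrite memT -!coef_map e.
Qed.

(** Splitting the product of chi with the minimal polynomials of generators of all the [E k]
    provides both the roots and all the embeddings. *)
Lemma common_splitting :
  exists (L : fieldExtType F) (z : 'I_b -> L)
    (s : forall k, 'I_(\dim {:E k}) -> 'AHom(E k, L)),
  [/\ injective z, map_poly (in_alg L) chi = \prod_s ('X - (z s)%:P),
      forall k, exists theta, injective (fun r => s k r theta) &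
      forall k (t : 'AHom(E k, L)), exists r, t =1 s k r].
Proof.
have /fin_all_exists[th thP] := factor_field_generator.
have /fin_all_exists[m mP] := fun k => minPoly1_alg (th k).
pose p := chi * \prod_k m k.
have m0 k : m k != 0.
  by rewrite -(map_poly_eq0 (in_alg (E k))) mP monic_neq0 ?monic_minPoly.
have p0 : p != 0.
  by rewrite mulf_neq0 ?(monic_neq0 chi_monic) //; apply/prodf_neq0 => k _.
have [L [ys eys]] := splitting_field p0; exists L.
have : map_poly (in_alg L) chi %| \prod_(z <- ys) ('X - z%:P).
  by rewrite -(eqp_dvdr _ eys) dvdp_map dvdp_mulr.
case/dvdp_prod_XsubC => B; set zs := mask B ys => ezs.
have {}ezs : map_poly (in_alg L) chi = \prod_(z <- zs) ('X - z%:P).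
  by apply/eqP; rewrite -eqp_monic ?map_chi_monic ?monic_prod_XsubC.
have szz : size zs = b.
  by apply/succn_inj; rewrite -chi_size -(size_map_poly (in_alg L)) ezs size_prod_XsubC.
have uz : uniq zs by rewrite -separable_prod_XsubC -ezs separable_map.
have ex k : exists s : 'I_(\dim {:E k}) -> 'AHom(E k, L),
    injective (fun r => s r (th k)) /\ forall t : 'AHom(E k, L), exists r, t =1 s r.
  have [gen sep] := thP k; apply: (separable_homs (ys := ys) gen sep (mP k)).
  rewrite -(eqp_dvdr _ eys) dvdp_map /p (bigD1 k) //= mulrCA.
  by rewrite dvdp_mulr.
have [s sP] := fin_all_exists ex.
exists (fun r : 'I_b => zs`_r), s; split.
- by move=> r r' /eqP; rewrite nth_uniq ?szz // => /eqP/val_inj.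
- by rewrite ezs (big_nth 0) szz big_mkord.
- by move=> k; exists (th k); have [] := sP k.
- by move=> k; have [] := sP k.
Qed.

Variable d : forall k, E k.
Arguments d : clear implicits.
(** The same [c] serves all embeddings, so it can be used inside [E k], before the trace is
    taken. *)
Hypothesis d_res : forall k, exists c : E k, c != 0 /\
  forall (L : fieldExtType F) (s : 'AHom(E k, L)) (xs ys : seq L),
    map_poly s (q k) = \prod_(x <- xs) ('X - x%:P) ->
    map_poly (in_alg L) chi =
      (\prod_(x <- xs) ('X - x%:P)) * \prod_(y <- ys) ('X - y%:P) ->
    s (d k) = s c ^+ 2 * \prod_(x <- xs) \prod_(y <- ys) (x - y).

Let T := oplus_seq [seq transfer1 (d k) | k <- enum 'I_N].

(** The embedded polynomials [q k] run exactly once through the factors of chi of degree [a], so the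
    sum of the traces turns into a sum over [a]-subsets. Counting the index set also gives the
    dimension. *)
Lemma factor_gram :
  projT1 T = #|ksubset b a| /\
  exists Q : 'M[F]_(#|ksubset b a|, projT1 T),
    Q *m projT2 T *m Q^T = (-1) ^+ i *: compound a (residue_mx b chi).
Proof.
have [L [z [s [z_inj chi_split s_inj s_all]]]] := common_splitting.
(* The balanced points over [L], as a closed point with an embedding of its residue field. *)
pose I := {k : 'I_N & 'I_(\dim {:E k})}.
have ex (p : I) : exists S : ksubset b a,
    map_poly (s (tag p) (tagged p)) (q (tag p)) = poly_of_set z (val S).
  have [||S eS] := @dvdp_poly_of_set _ _ z (map_poly (s (tag p) (tagged p)) (q (tag p))).
  - by rewrite monic_map ?q_monic.
  - by rewrite -chi_split -(map_ahom_alg (s (tag p) (tagged p))) dvdp_map q_dvd.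
  have cS : #|S| == a.
    by rewrite -eqSS -(size_poly_of_set z) -eS size_map_poly q_size.
  by exists (Sub S cS); rewrite eS.
have [Sf SfP] := fin_all_exists ex.
have Sf_inj : injective Sf.
  move=> [k r] [k' r'] e; have e1 := SfP (existT _ k r : I); have e2 := SfP (existT _ k' r' : I).
  rewrite /= in e1 e2; have e3 : map_poly (s k r) (q k) = map_poly (s k' r') (q k').
    by rewrite e1 e2 e.
  have [t tP] := factor_homs_distinct e3.
  have kk : k = k'.
    apply: (@q_distinct k k' t); apply: (map_inj_poly (fmorph_inj (s k' r'))).
      exact: rmorph0.
    by rewrite -e3 -map_poly_comp; apply: eq_map_poly => x; rewrite tP.
  subst k'; congr (existT _ k _); have [th th_inj] := s_inj k.
  by apply: th_inj; apply: factor_hom_unique.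
have Sf_surj S : exists p, Sf p = S.
  have eS : map_poly (in_alg L) chi = \prod_(x <- [seq z r | r <- enum 'I_b]) ('X - x%:P).
    by rewrite big_map big_enum.
  have [||k [t tP]] := q_all eS (monic_poly_of_set z (val S)).
  - by rewrite size_poly_of_set (eqP (valP S)).
  - rewrite chi_split (bigID (mem (val S))) /=; exact: dvdp_mulr.
  have [r er] := s_all k t; exists (existT _ k r : I).
  apply/val_inj/(poly_of_set_inj z_inj); rewrite -SfP /= -tP.
  by apply: eq_map_poly => x; rewrite er.
have Sf_bij : bijective Sf.
  apply: inj_card_bij => //; rewrite -(card_codom Sf_inj).
  by apply: subset_leq_card; apply/subsetP => S _; have [p <-] := Sf_surj S; apply: codom_f.
split.
  rewrite /T oplus_seq_size big_enum /= -(bij_eq_card Sf_bij) -sum1_card.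
  rewrite -(sig_big_dep xpredT (fun k => xpredT)
     (fun k (r : 'I_(\dim {:E k})) => 1%N)) /=.
  by apply: eq_bigr => k _; rewrite sum1_card card_ord.
have [c cP] := fin_all_exists d_res.
pose dt k (x : 'I_#|ksubset b a|) := \det (rowsub (ksubset_elt (enum_val x)) (rem_mx b a (q k))).
(* With [d k] equal to c^2 times the resultant, d u_x u_y is the product of two minors divided by
   the resultant: the factor 1/d moves the resultant to the denominator. *)
pose u k x := c k / d k * dt k x.
have [Q eQ] := oplus_seq_gram (enum 'I_N) (x := fun k => transfer1 (d k))
  (fun k => \matrix_(x < #|ksubset b a|, r < projT1 (transfer1 (d k)))
     coord (vbasis {:E k}) r (u k x)).
exists Q; rewrite eQ; apply/matrixP => x y; rewrite summxE big_enum /=.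
under eq_bigr => k _ do rewrite (transfer1_gram (d k) (u k)).
apply: (fmorph_inj (in_alg L)); rewrite mxE rmorphM rmorph_sign /=.
rewrite (compound_residue_mx chi_monic chi_size z_inj chi_split) scaler_suml.
rewrite (reindex Sf) /=; last exact: onW_bij.
transitivity (\sum_(p : I) s (tag p) (tagged p)
    (d (tag p) * u (tag p) x * u (tag p) y)).
  rewrite -(sig_big_dep xpredT (fun k => xpredT)
     (fun k r => s k r (d k * u k x * u k y))) /=.
  apply: eq_bigr => k _; have [th th_inj] := s_inj k.
  exact: ftrace_sum_ahom th_inj _.
apply: eq_bigr => p _; move: (SfP p); set k := tag p; set t := s k _ => e.
have dtE x' : t (dt k x') =
    \det (rowsub (ksubset_elt (enum_val x')) (rem_mx b a (poly_of_set z (val (Sf p))))).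
  rewrite -[LHS]det_map_mx; congr (\det _); apply/matrixP => v w.
  by rewrite !mxE -e -[LHS]coef_map map_modp map_polyXn.
rewrite -!dtE; have [c0 /(_ L t)] := cP k.
move=> /(_ [seq z r | r <- enum (val (Sf p))] [seq z r | r <- enum (~: val (Sf p))]).
rewrite !big_map !big_enum /= => /(_ e) dE.
have {}dE : t (d k) = t (c k) ^+ 2 * set_res z (val (Sf p)).
  rewrite dE; last first.
    rewrite chi_split (bigID (mem (val (Sf p)))) /=; congr (_ * _).
    by apply: eq_bigl => r; rewrite inE.
  congr (_ * _); apply: eq_bigr => r _.
  by rewrite big_map big_enum.
have tc0 : t (c k) != 0 by rewrite fmorph_eq0.
have r0 := set_res_neq0 z_inj (val (Sf p)).
have tV : t (d k)^-1 = (t (c k) ^+ 2 * set_res z (val (Sf p)))^-1 by rewrite fmorphV; congr (_^-1).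
rewrite /u !rmorphM /= tV dE; field; by rewrite tc0 r0.
Qed.

Lemma factor_form j : b = (j + j)%N -> (2%:R : F) != 0 ->
  isometric T (pm_form F (('C(2 * j, 2 * i) + 'C(j, i)) %/ 2)
                         (('C(2 * j, 2 * i) - 'C(j, i)) %/ 2)).
Proof.
move=> eb n2; have [szT [Q eQ]] := factor_gram.
have uB : residue_mx b chi \in unitmx.
  have [L [z [s [z_inj chi_split _ _]]]] := common_splitting.
  exact: residue_mx_unit chi_monic chi_size _ _ z_inj chi_split.
have [|P eP] := hyperbolic_diag_cast eb n2 (residue_mx_sym b chi) uB.
  move=> u v uj vj; have lt : (u + v < b.-1)%N.
    move: (nat_of_ord u) (nat_of_ord v) uj vj => u' v' uj vj; rewrite eb.
    by case: (j) uj vj => // j'; rewrite addSn addnS !ltnS => *; apply: leq_add.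
  rewrite mxE modp_small ?coefXn ?gtn_eqF //.
  by rewrite size_polyXn chi_size ltnS (leq_trans lt) ?leq_pred.
have [] := card_signed_ksubset_cast i eb; set p := #|_| => ep en.
pose sg (S : ksubset b a) : int := \prod_(s in val S) (if (s < j)%N then 1 else -1).
(* The diagonal entry at S is (-1)^i times its sign, so it equals 1 when the sign is (-1)^i. *)
rewrite -ep; apply: (@isometric_pm_form _ _ _ _ _ (compound a P *m Q)
  [pred x : 'I_#|ksubset b a| | sg (enum_val x) == (-1) ^+ i]) => //.
  rewrite /p -sum1_card -[RHS]sum1_card [RHS](reindex (@enum_val (ksubset b a) (ksubset b a))) /=; last first.
    by apply: onW_bij; apply: enum_val_bij.
  by apply: eq_bigl => x; rewrite !inE.
rewrite trmx_mul mulmxA -(mulmxA (compound a P)) -(mulmxA (compound a P)) eQ.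
rewrite -scalemxAr -scalemxAl -compound_tr -!compoundM eP compound_diag.
apply/matrixP => x y; rewrite !mxE mulrnAr; congr (_ *+ _).
rewrite inE; set S := enum_val x.
have -> : \prod_(s in val S) (\row_r (if (r < j)%N then 1 else -1 : F)) 0 s = (sg S)%:~R.
  rewrite rmorph_prod; apply: eq_bigr => s _; rewrite mxE.
  by case: ifP.
have : sg S ^+ 2 = 1 by rewrite -prodrXl big1 // => s _; case: ifP.
have eF : (-1 : F) ^+ i = (-1) ^+ (odd i) by rewrite signr_odd.
have eZ : (-1 : int) ^+ i = (-1) ^+ (odd i) by rewrite signr_odd.
rewrite eF eZ => /eqP; rewrite sqrf_eq1 => /orP[]/eqP ->.
  by case: (odd i); rewrite ?mulN1r ?mul1r ?rmorph1.
by case: (odd i); rewrite ?mulN1r ?mul1r ?rmorphN ?rmorph1 ?opprK.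
Qed.

End FactorAlgebra.

(** * Multiplication operators on matrices *)

Lemma index_allpairs_pair (T1 T2 : eqType) (s : seq T1) (t : seq T2) x y :
  x \in s -> y \in t ->
  index (x, y) [seq (x', y') | x' <- s, y' <- t] = (index x s * size t + index y t)%N.
Proof.
move=> xs yt; elim: s xs => // x' s IH.
rewrite inE /= index_cat (eq_sym x) => xs.
have [->|ne] := eqVneq x' x.
  by rewrite map_f ?index_map // => u v [].
rewrite ifN; last by apply: contra ne => /mapP[y' _ [->]].
rewrite size_map IH ?mulSn ?addnA //.
by move: xs; rewrite (negPf ne).
Qed.

(** Shows that [mxvec] is row-major, so that cutting a matrix into upper and lower halves does not
    permute its entries. *)
Lemma val_mxvec_index m n (i : 'I_m) (j : 'I_n) : val (mxvec_index i j) = (i * n + j)%N.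
Proof.
rewrite /mxvec_index /= -[RHS]/((i * n + j)%N) /enum_rank.
rewrite [enum_rank_in]unlock insubdK /=; last by rewrite unfold_in cardE index_mem mem_enum.
rewrite enumT unlock /= /prod_enum.
rewrite index_allpairs_pair ?mem_enum //.
by rewrite !index_enum_ord size_enum_ord.
Qed.

Section LeftRight.

Variable K : fieldType.

Local Notation L := (@lin_mulmx K _ _ _).
Local Notation R := (@lin_mulmxr K _ _ _).

Lemma eq_mxvec m n p (A B : 'M[K]_(m * n, p)) :
  (forall v : 'M_(m, n), mxvec v *m A = mxvec v *m B) -> A = B.
Proof.
by move=> AB; apply/row_matrixP => k; rewrite !rowE -[delta_mx 0 k]vec_mxK AB.
Qed.

Lemma mxvec_lin_mulmx m n p (A : 'M[K]_(m, n)) (v : 'M_(n, p)) : mxvec v *m L A = mxvec (A *m v).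
Proof. by rewrite mul_vec_lin. Qed.

Lemma mxvec_lin_mulmxr m n p (A : 'M[K]_(n, p)) (v : 'M_(m, n)) : mxvec v *m R A = mxvec (v *m A).
Proof. by rewrite mul_vec_lin. Qed.

Lemma lin_mulmx_comp m n p q (A : 'M[K]_(n, p)) (B : 'M_(m, n)) :
  (L A : 'M_(p * q, _)) *m L B = L (B *m A).
Proof. by apply: eq_mxvec => v; rewrite mulmxA !mxvec_lin_mulmx mulmxA. Qed.

Lemma lin_mulmxr_comp m n p q (A : 'M[K]_(n, p)) (B : 'M_(p, q)) :
  (R A : 'M_(m * n, _)) *m R B = R (A *m B).
Proof. by apply: eq_mxvec => v; rewrite mulmxA !mxvec_lin_mulmxr mulmxA. Qed.

Lemma lin_mulmxr_mulmxC m n p q (A : 'M[K]_(m, n)) (B : 'M_(p, q)) :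
  R B *m L A = L A *m R B.
Proof. by apply: eq_mxvec => v; rewrite !mulmxA mxvec_lin_mulmx !mxvec_lin_mulmxr mxvec_lin_mulmx mulmxA. Qed.

Lemma lin_mulmx_1 m n : (L (1%:M : 'M[K]_m) : 'M_(m * n, _)) = 1%:M.
Proof. by apply: eq_mxvec => v; rewrite mxvec_lin_mulmx mul1mx mulmx1. Qed.

Lemma lin_mulmxr_1 m n : (R (1%:M : 'M[K]_n) : 'M_(m * n, _)) = 1%:M.
Proof. by apply: eq_mxvec => v; rewrite mxvec_lin_mulmxr !mulmx1. Qed.

Lemma lin_mulmx_D m n p (A B : 'M[K]_(m, n)) : (L (A + B) : 'M_(n * p, _)) = L A + L B.
Proof. by rewrite linearD. Qed.

Lemma lin_mulmx_0 m n p : (L (0 : 'M[K]_(m, n)) : 'M_(n * p, _)) = 0.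
Proof. by rewrite linear0. Qed.

Lemma lin_mulmxr_D m n p (A B : 'M[K]_(n, p)) : (R (A + B) : 'M_(m * n, _)) = R A + R B.
Proof. by rewrite linearD. Qed.

Lemma lin_mulmxr_N m n p (A : 'M[K]_(n, p)) : (R (- A) : 'M_(m * n, _)) = - R A.
Proof. by rewrite linearN. Qed.

Lemma lin_mulmxr_0 m n p : (R (0 : 'M[K]_(n, p)) : 'M_(m * n, _)) = 0.
Proof. by rewrite linear0. Qed.

(** Sizes such as (m + m) * n and m * n + m * n are only propositionally equal; mutually inverse
    rectangular matrices allow determinants to be compared without casts. *)
Lemma det_similar m n (A : 'M[K]_m) (B : 'M_n) (T : 'M_(m, n)) (T' : 'M_(n, m)) :
  T *m T' = 1%:M -> T' *m T = 1%:M -> A *m T = T *m B -> \det A = \det B.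
Proof.
move=> e1 e2 e3.
have mn : m = n.
  apply/eqP; rewrite eqn_leq; apply/andP; split.
    rewrite -(mxrank1 K m) -e1; exact: leq_trans (mxrankM_maxl _ _) (rank_leq_col _).
  rewrite -(mxrank1 K n) -e2; exact: leq_trans (mxrankM_maxl _ _) (rank_leq_col _).
subst n; have uT : T \in unitmx by case: (mulmx1_unit e1).
have -> : A = T *m B *m invmx T by rewrite -e3 mulmxK.
by rewrite !det_mulmx det_inv mulrAC mulfV ?mul1r // -unitfE -unitmxE.
Qed.

Lemma colrow_split m n : (col_mx 1%:M 0 *m row_mx 1%:M 0 + col_mx 0 1%:M *m row_mx 0 1%:M)
   = 1%:M :> 'M[K]_(m + n).
Proof.
rewrite !mul_col_row !(mul1mx, mulmx1, mul0mx, mulmx0) add_block_mx !addr0 !add0r.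
by rewrite -scalar_mx_block.
Qed.

(** Left multiplication acts in the same way on the two halves of the columns. *)
Lemma det_lin_mulmx_double m n (A : 'M[K]_m) : exists c : K,
  \det (L A : 'M_(m * (n + n))) = c ^+ 2.
Proof.
exists (\det (L A : 'M_(m * n))); rewrite expr2 -(det_ublock _ 0).
pose T := row_mx (R (col_mx 1%:M 0)) (R (col_mx 0 1%:M)) : 'M[K]_(m * (n + n), m * n + m * n).
pose T' := col_mx (R (row_mx 1%:M 0)) (R (row_mx 0 1%:M)) : 'M[K]_(m * n + m * n, m * (n + n)).
apply: (det_similar (T := T) (T' := T')).
- by rewrite mul_row_col !lin_mulmxr_comp -lin_mulmxr_D colrow_split lin_mulmxr_1.
- rewrite mul_col_row !lin_mulmxr_comp !mul_row_col !(mulmx0, mul0mx, mulmx1, addr0, add0r).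
  by rewrite !lin_mulmxr_0 !lin_mulmxr_1 -scalar_mx_block.
- by rewrite mul_mx_row mul_row_block !mulmx0 addr0 add0r !lin_mulmxr_mulmxC.
Qed.

Lemma det_lin_mulmxr_double m n (A : 'M[K]_n) : exists c : K,
  \det (R A : 'M_((m + m) * n)) = c ^+ 2.
Proof.
exists (\det (R A : 'M_(m * n))); rewrite expr2 -(det_ublock _ 0).
pose T := row_mx (L (row_mx 1%:M 0)) (L (row_mx 0 1%:M)) : 'M[K]_((m + m) * n, m * n + m * n).
pose T' := col_mx (L (col_mx 1%:M 0)) (L (col_mx 0 1%:M)) : 'M[K]_(m * n + m * n, (m + m) * n).
apply: (det_similar (T := T) (T' := T')).
- by rewrite mul_row_col !lin_mulmx_comp -lin_mulmx_D colrow_split lin_mulmx_1.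
- rewrite mul_col_row !lin_mulmx_comp !mul_row_col !(mulmx0, mul0mx, mulmx1, addr0, add0r).
  by rewrite !lin_mulmx_0 !lin_mulmx_1 -scalar_mx_block.
- by rewrite mul_mx_row mul_row_block !mulmx0 addr0 add0r !lin_mulmxr_mulmxC.
Qed.

Lemma lin_mulmx_unit m n (A : 'M[K]_m) : A \in unitmx -> (L A : 'M_(m * n)) \in unitmx.
Proof.
move=> uA; have : (L A : 'M_(m * n)) *m L (invmx A) = 1%:M by rewrite lin_mulmx_comp mulVmx ?lin_mulmx_1.
by case/mulmx1_unit.
Qed.

Lemma lin_mulmxr_unit m n (A : 'M[K]_n) : A \in unitmx -> (R A : 'M_(m * n)) \in unitmx.
Proof.
move=> uA; have : (R A : 'M_(m * n)) *m R (invmx A) = 1%:M by rewrite lin_mulmxr_comp mulmxV ?lin_mulmxr_1.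
by case/mulmx1_unit.
Qed.

Definition sylvester m n (X : 'M[K]_m) (Z : 'M[K]_n) : K := \det (L X - R Z).

Lemma sylvester_similar m n (X X' : 'M[K]_m) (P : 'M_m) (Z : 'M[K]_n) :
  P \in unitmx -> P *m X = X' *m P -> sylvester X Z = sylvester X' Z.
Proof.
move=> uP e; apply: (det_similar (T := L P) (T' := L (invmx P))).
- by rewrite lin_mulmx_comp mulVmx ?lin_mulmx_1.
- by rewrite lin_mulmx_comp mulmxV ?lin_mulmx_1.
- by rewrite mulmxBl mulmxBr !lin_mulmx_comp e lin_mulmxr_mulmxC.
Qed.

Lemma sylvester_block m1 m2 n (X1 : 'M[K]_m1) (X2 : 'M_m2) (Y : 'M_(m2, m1)) (Z : 'M[K]_n) :
  sylvester (block_mx X1 0 Y X2) Z = sylvester X1 Z * sylvester X2 Z.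
Proof.
rewrite /sylvester -(det_ublock _ (L Y)).
pose T := row_mx (L (row_mx 1%:M 0)) (L (row_mx 0 1%:M)) : 'M[K]_((m1 + m2) * n, m1 * n + m2 * n).
pose T' := col_mx (L (col_mx 1%:M 0)) (L (col_mx 0 1%:M)) : 'M[K]_(m1 * n + m2 * n, (m1 + m2) * n).
apply: (det_similar (T := T) (T' := T')).
- by rewrite mul_row_col !lin_mulmx_comp -lin_mulmx_D colrow_split lin_mulmx_1.
- rewrite mul_col_row !lin_mulmx_comp !mul_row_col !(mulmx0, mul0mx, mulmx1, addr0, add0r).
  by rewrite !lin_mulmx_0 !lin_mulmx_1 -scalar_mx_block.
- rewrite mul_mx_row mul_row_block !mulmx0 addr0.
  rewrite !mulmxBl !mulmxBr !lin_mulmx_comp !mul_row_block !lin_mulmxr_mulmxC.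
  rewrite !(mulmx0, mul0mx, mul1mx, addr0, add0r); congr row_mx.
    by rewrite mul_mx_row mulmx1 mulmx0.
  rewrite addrA -lin_mulmx_D !mul_mx_row !(mulmx0, mulmx1) add_row_mx addr0 add0r //.
Qed.

Lemma sylvester_scalar n x (Z : 'M[K]_n) : sylvester (x%:M : 'M_1) Z = (char_poly Z).[x].
Proof.
have -> : (char_poly Z).[x] = \det (x%:M - Z).
  rewrite -[LHS]/(horner_eval x _) -det_map_mx; congr (\det _).
  apply/matrixP => r s; rewrite !mxE rmorphB /= rmorphMn /= /horner_eval.
  by rewrite hornerX hornerC.
pose T := lin1_mx (vec_mx : 'rV[K]_(1 * n) -> 'rV_n).
pose T' := lin1_mx (mxvec : 'rV[K]_n -> 'rV_(1 * n)).
apply: (det_similar (T := T) (T' := T')).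
- by apply/row_matrixP => k; rewrite !rowE mulmxA !mul_rV_lin1 /= vec_mxK mulmx1.
- by apply/row_matrixP => k; rewrite !rowE mulmxA !mul_rV_lin1 /= mxvecK mulmx1.
apply: eq_mxvec => v; rewrite !mulmxA mulmxBr mxvec_lin_mulmx mxvec_lin_mulmxr -linearB /=.
by rewrite !mul_rV_lin1 /= !mxvecK mulmxBr mul_scalar_mx mul_mx_scalar.
Qed.

End LeftRight.

(** * Invariant subspaces and characteristic polynomials *)

Section Invariant.

Variable K : fieldType.

Lemma char_poly_similar n (P A B : 'M[K]_n) :
  P \in unitmx -> P *m A = B *m P -> char_poly A = char_poly B.
Proof.
move=> uP e; have -> : A = invmx P *m B *m P by rewrite -mulmxA -e mulKmx.
rewrite /char_poly /char_poly_mx !map_mxM /=.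
have e1 : map_mx polyC (invmx P) *m map_mx polyC P = 1%:M.
  by rewrite -map_mxM mulVmx ?map_mx1.
have -> : 'X%:M - map_mx polyC (invmx P) *m map_mx polyC B *m map_mx polyC P =
    map_mx polyC (invmx P) *m ('X%:M - map_mx polyC B) *m map_mx polyC P.
  by rewrite mulmxBr mulmxBl mul_mx_scalar -scalemxAl e1 scalemx1.
by rewrite !det_mulmx mulrAC -det_mulmx e1 det1 mul1r.
Qed.

Lemma char_poly_lblock m n (X : 'M[K]_m) (Y : 'M_(n, m)) (Z : 'M_n) :
  char_poly (block_mx X 0 Y Z) = char_poly X * char_poly Z.
Proof.
rewrite /char_poly -(det_lblock _ (- map_mx polyC Y)); congr (\det _).
rewrite /char_poly_mx map_block_mx map_mx0 scalar_mx_block opp_block_mx add_block_mx.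
by rewrite oppr0 !add0r.
Qed.

(** The rows of [A] span an invariant subspace and those of [B] a complement; [X] and [Z] are phi on
    the subspace and on the quotient. The size [b] is a separate variable, as the application has e
    = b - a. *)
Definition adapted a e b (phi : 'M[K]_b) (A : 'M_(a, b)) (B : 'M_(e, b)) X Y Z :=
  [/\ b = (a + e)%N, \rank (col_mx A B) = (a + e)%N, A *m phi = X *m A &
      B *m phi = Y *m A + Z *m B].

Lemma adapted_exists a e b (phi : 'M[K]_b) (A : 'M_(a, b)) :
  b = (a + e)%N -> \rank A = a -> (A *m phi <= A)%MS ->
  exists B X Y Z, @adapted a e b phi A B X Y Z.
Proof.
move=> eb; subst b => rA /submxP[X eX].
have rC : \rank (A^C)%MS = e.
  by have := mxrank_compl A; rewrite rA addKn.
pose B := castmx (rC, erefl) (row_base (A^C)%MS).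
have eB : (B :=: A^C)%MS.
  by apply: eqmx_trans (eqmx_cast _ _) (eq_row_base _).
have full : row_full (col_mx A B).
  rewrite -sub1mx -addsmxE (eqmxP (_ : (A + B == A + A^C)%MS)).
    by rewrite sub1mx addsmx_compl_full.
  by apply/eqmxP; apply: adds_eqmx.
have : (B *m phi <= col_mx A B)%MS by rewrite submx_full.
case/submxP => D; rewrite -[D]hsubmxK mul_row_col => eD.
exists B, X, (lsubmx D), (rsubmx D); split=> //.
by move/eqP: full.
Qed.

Lemma adapted_unit a e b (phi : 'M[K]_b) A B X Y Z : @adapted a e b phi A B X Y Z ->
  col_mx A B *m phi = block_mx X 0 Y Z *m col_mx A B.
Proof.
by case=> _ _ e1 e2; rewrite mul_col_mx mul_block_col mul0mx addr0 e1 e2.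
Qed.

Lemma adapted_char_poly a e b (phi : 'M[K]_b) A B X Y Z :
  @adapted a e b phi A B X Y Z -> char_poly phi = char_poly X * char_poly Z.
Proof.
move=> ad; have := adapted_unit ad; case: ad => eb rk _ _; subst b.
rewrite -(char_poly_lblock X Y Z); apply: char_poly_similar.
by rewrite -row_full_unit; apply/eqP.
Qed.

(** An eigenvector is split off and the invariant subspace found in the quotient is pulled back.
    Repeated roots are allowed: separability of chi is proved by applying this to a double root. *)
Lemma triangular_sub e (xs : seq K) (phi : 'M[K]_(size xs + e)) (r : {poly K}) :
  char_poly phi = (\prod_(x <- xs) ('X - x%:P)) * r ->
  exists (A : 'M_(size xs, size xs + e)) (X : 'M_(size xs)),
    [/\ \rank A = size xs, A *m phi = X *m A & char_poly X = \prod_(x <- xs) ('X - x%:P)].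
Proof.
elim: xs phi => [|x xs IH] phi ephi.
  exists 0, 0; split; first by rewrite mxrank0.
    by rewrite !mul0mx.
  by rewrite big_nil /char_poly det_mx00.
have : root (char_poly phi) x.
  by rewrite ephi big_cons -mulrA rootM root_XsubC eqxx.
rewrite -eigenvalue_root_char => /eigenvalueP[v ev v0].
have rv : \rank v = 1%N by rewrite rank_rV v0.
have vs : (v *m phi <= v)%MS by rewrite ev scalemx_sub.
have [B [X1 [Y [Z ad]]]] :=
  @adapted_exists 1 (size xs + e) (size xs + e).+1 phi v (erefl _) rv vs.
have eX1 : X1 = x%:M.
  case: ad => _ _ e1 _; move: e1; rewrite ev -mul_scalar_mx.
  by move/(row_free_inj (_ : row_free v)) => -> //; rewrite /row_free rv.
have := adapted_char_poly ad; rewrite ephi eX1 big_cons -mulrA.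
have -> : char_poly (x%:M : 'M[K]_1) = 'X - x%:P.
  rewrite /char_poly det_mx11 !mxE eqxx mulr1n //.
move/(mulfI (negbT (polyXsubC_eq0 x)))/esym/IH => [A1 [X [rA1 eA1 eX]]].
case: (ad) => _ rk e1 e2.
exists (col_mx v (A1 *m B) : 'M_(1 + size xs, _)), (block_mx x%:M 0 (A1 *m Y) X); split.
- have -> : col_mx v (A1 *m B) = block_mx 1%:M 0 0 A1 *m col_mx v B.
    by rewrite mul_block_col !mul0mx mul1mx addr0 add0r.
  rewrite mxrankMfree; last by rewrite /row_free rk.
  by rewrite [LHS](rank_diag_block_mx (1%:M : 'M[K]_1) A1) mxrank1 rA1.
- rewrite [LHS](mul_col_mx v (A1 *m B) phi) [RHS](mul_block_col x%:M 0 (A1 *m Y) X v).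
  by rewrite mul0mx addr0 e1 eX1 -(mulmxA A1 B) e2 mulmxDr !mulmxA eA1.
- rewrite [LHS](char_poly_lblock (x%:M : 'M_1) (A1 *m Y) X) eX.
  by rewrite /char_poly det_mx11 !mxE eqxx mulr1n.
Qed.

(** Splitting off eigenvectors of [X] reduces to size one, where the operator is right
    multiplication by x - Z. *)
Lemma sylvester_prod (xs : seq K) (X : 'M[K]_(size xs)) n (Z : 'M[K]_n) :
  char_poly X = \prod_(x <- xs) ('X - x%:P) ->
  sylvester X Z = \prod_(x <- xs) (char_poly Z).[x].
Proof.
elim: xs X => [|x xs IH] X eX.
  rewrite big_nil /sylvester; move: (lin_mulmx X - lin_mulmxr Z) => M.
  exact: det_mx00.
have : root (char_poly X) x by rewrite eX big_cons rootM root_XsubC eqxx.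
rewrite -eigenvalue_root_char => /eigenvalueP[v ev v0].
have rv : \rank v = 1%N by rewrite rank_rV v0.
have vs : (v *m X <= v)%MS by rewrite ev scalemx_sub.
have [B [X1 [Y [X2 ad]]]] :=
  @adapted_exists 1 (size xs) (size xs).+1 X v (erefl _) rv vs.
have eX1 : X1 = x%:M.
  case: ad => _ _ e1 _; move: e1; rewrite ev -mul_scalar_mx.
  by move/(row_free_inj (_ : row_free v)) => -> //; rewrite /row_free rv.
have := adapted_char_poly ad; rewrite eX eX1 big_cons.
have -> : char_poly (x%:M : 'M[K]_1) = 'X - x%:P.
  rewrite /char_poly det_mx11 !mxE eqxx mulr1n //.
move/(mulfI (negbT (polyXsubC_eq0 x)))/esym/IH => eX2.
have := adapted_unit ad; rewrite eX1 => e1.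
rewrite (sylvester_similar (P := (col_mx v B : 'M_(1 + size xs))) _ _ e1).
  by rewrite sylvester_block sylvester_scalar eX2 big_cons.
by case: ad => _ rk _ _; rewrite -row_full_unit; apply/eqP.
Qed.

End Invariant.

Lemma map_sylvester (K K' : fieldType) (f : {rmorphism K -> K'}) m n
    (X : 'M[K]_m) (Z : 'M[K]_n) :
  f (sylvester X Z) = sylvester (map_mx f X) (map_mx f Z).
Proof.
rewrite /sylvester -det_map_mx map_mxB; congr (\det (_ - _)); apply: map_lin_mx => A.
  by rewrite map_mxM.
by rewrite /= map_mxM.
Qed.

(** * The splitting map *)

Section Kernel.

Variable K : fieldType.

(* [horner_mx] is only defined for matrices of positive size. *)
Definition gen_horner_mx n : 'M[K]_n -> {poly K} -> 'M[K]_n :=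
  if n is n'.+1 then fun A p => horner_mx A p else fun _ _ => 0.

Lemma gen_horner_mxC n (A : 'M[K]_n) c : gen_horner_mx A c%:P = c%:M.
Proof. by case: n A => [|n] A; [rewrite [LHS]flatmx0 [RHS]flatmx0 | apply: horner_mx_C]. Qed.

Lemma gen_horner_mxX n (A : 'M[K]_n) : gen_horner_mx A 'X = A.
Proof. by case: n A => [|n] A; [rewrite [LHS]flatmx0 [RHS]flatmx0 | apply: horner_mx_X]. Qed.

Lemma gen_horner_mxD n (A : 'M[K]_n) p q : gen_horner_mx A (p + q) = gen_horner_mx A p + gen_horner_mx A q.
Proof. by case: n A => [|n] A; [rewrite [LHS]flatmx0 [RHS]flatmx0 | apply: rmorphD]. Qed.

Lemma gen_horner_mxM n (A : 'M[K]_n) p q : gen_horner_mx A (p * q) = gen_horner_mx A p *m gen_horner_mx A q.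
Proof. by case: n A => [|n] A; [rewrite [LHS]flatmx0 [RHS]flatmx0 | apply: rmorphM]. Qed.

Lemma gen_Cayley_Hamilton n (A : 'M[K]_n) : gen_horner_mx A (char_poly A) = 0.
Proof. by case: n A => [|n] A; [apply: flatmx0 | apply: Cayley_Hamilton]. Qed.

Lemma gen_horner_mx_intertwine m n (A : 'M[K]_(m, n)) (phi : 'M_n) (X : 'M_m) p :
  A *m phi = X *m A -> A *m gen_horner_mx phi p = gen_horner_mx X p *m A.
Proof.
move=> e; elim/poly_ind: p => [|p c IH].
  by rewrite -polyC0 !gen_horner_mxC mul_scalar_mx mul_mx_scalar.
rewrite !gen_horner_mxD !gen_horner_mxM !gen_horner_mxX !gen_horner_mxC mulmxDr mulmxDl.
by rewrite mulmxA IH -mulmxA e mulmxA mul_scalar_mx mul_mx_scalar.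
Qed.

(** Write q for the characteristic polynomial of [X]. By a Bezout relation and Cayley-Hamilton q(Z)
    is invertible, and q(phi) is block triangular with blocks 0 and q(Z), so its kernel has no
    component along [B]. Thus [A] is recovered from q alone. *)
Lemma adapted_kernel a e b (phi : 'M[K]_b) A B X Y Z : @adapted K a e b phi A B X Y Z ->
  coprimep (char_poly X) (char_poly Z) -> (A :=: kermxpoly phi (char_poly X))%MS.
Proof.
move=> ad cop; set q := char_poly X.
have uqZ : gen_horner_mx Z q \in unitmx.
  have /Bezout_eq1_coprimepP[[u v] /= euv] := cop.
  have : gen_horner_mx Z u *m gen_horner_mx Z q = 1%:M.
    have /(congr1 (gen_horner_mx Z)) := euv; rewrite gen_horner_mxD !gen_horner_mxM -polyC1 gen_horner_mxC.
    by rewrite gen_Cayley_Hamilton mulmx0 addr0.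
  by case/mulmx1_unit.
have eA : A *m gen_horner_mx phi q = 0.
  case: ad => _ _ e1 _; rewrite (gen_horner_mx_intertwine _ e1) gen_Cayley_Hamilton.
  by rewrite mul0mx.
have [Y' eB] : exists Y', B *m gen_horner_mx phi q = Y' *m A + gen_horner_mx Z q *m B.
  case: ad => _ _ e1 e2; elim/poly_ind: (q) => [|p c [Y' IH]].
    by exists 0; rewrite -polyC0 !gen_horner_mxC !(mul_scalar_mx, mul_mx_scalar, scale0r) mul0mx addr0.
  exists (Y' *m X + gen_horner_mx Z p *m Y).
  rewrite !gen_horner_mxD !gen_horner_mxM !gen_horner_mxX !gen_horner_mxC mulmxDr.
  rewrite mulmxA IH mulmxDl -(mulmxA Y') e1 -(mulmxA _ B) e2 mulmxDr.
  rewrite !mulmxDl !mulmxA mul_scalar_mx mul_mx_scalar !addrA.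
  by congr (_ + _ + _); rewrite addrC.
have -> : kermxpoly phi q = kermx (gen_horner_mx phi q) by case: b phi {ad A B eA Y' eB} => //.
apply/eqmxP/andP; split; first by apply/sub_kermxP.
have full : (kermx (gen_horner_mx phi q) <= col_mx A B)%MS.
  case: ad => eb rk _ _; subst b; apply: submx_full.
  by rewrite /row_full rk.
case/submxP: full => D; rewrite -[D]hsubmxK mul_row_col => eD.
have /(congr1 (mulmx (kermx (gen_horner_mx phi q)))) : gen_horner_mx phi q = gen_horner_mx phi q by [].
rewrite {1}mulmx_ker {1}eD mulmxDl -!mulmxA eA mulmx0 add0r eB.
rewrite mulmxDr !mulmxA => /esym e0.
have : row_mx (rsubmx D *m Y') (rsubmx D *m gen_horner_mx Z q) *m col_mx A B = 0.
  by rewrite mul_row_col.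
rewrite -(mul0mx _ (col_mx A B)) => /(row_free_inj (_ : row_free (col_mx A B))).
rewrite /row_free; case: (ad) => _ -> _ _; rewrite eqxx => /(_ isT).
rewrite -row_mx0 => /eq_row_mx[_ /(congr1 (mulmxr (invmx (gen_horner_mx Z q))))] /=.
rewrite mulmxK // mul0mx => D0.
by rewrite eD D0 mul0mx addr0 submxMl.
Qed.

End Kernel.

(** * The determinant of the splitting map in standard bases *)

Section XiMatrix.

Variable K : fieldType.
Local Notation L := (@lin_mulmx K _ _ _).
Local Notation R := (@lin_mulmxr K _ _ _).

(** The form of the determinant in [xi_det_rep], whose two sizes agree only propositionally. *)
Definition det_cast n p (M : 'M[K]_(n, p)) := \det (conform_mx (0 : 'M_n) M).

Lemma det_cast_id n (M : 'M[K]_n) : det_cast M = \det M.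
Proof. by rewrite /det_cast conform_mx_id. Qed.

Lemma det_castMl n p (A : 'M[K]_n) (M : 'M[K]_(n, p)) : n = p ->
  det_cast (A *m M) = \det A * det_cast M.
Proof. by move=> e; subst p; rewrite !det_cast_id det_mulmx. Qed.

Lemma det_castMr n p (M : 'M[K]_(n, p)) (B : 'M[K]_p) : n = p ->
  det_cast (M *m B) = det_cast M * \det B.
Proof. by move=> e; subst p; rewrite !det_cast_id det_mulmx. Qed.

Lemma det_cast_neq0 n p (M : 'M[K]_(n, p)) (M' : 'M[K]_(p, n)) : n = p ->
  M *m M' = 1%:M -> det_cast M != 0.
Proof.
move=> e; subst p => /mulmx1_unit[uM _]; by rewrite det_cast_id -unitfE -unitmxE.
Qed.

Lemma det_cast_block n m p (T : 'M[K]_(n, m + m)) (M : 'M_(m, p)) :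
  n = (m + m)%N -> m = p -> det_cast (T *m block_mx M 0 0 M) = det_cast T * det_cast M ^+ 2.
Proof.
move=> en ep; subst p n; by rewrite !det_cast_id det_mulmx det_ublock expr2.
Qed.

Lemma det_cast_eq1 n p (M : 'M[K]_(n, p)) : n = p ->
  (forall k l, M k l = (k == l :> nat)%:R) -> det_cast M = 1.
Proof.
move=> e; subst p => eM; rewrite det_cast_id (_ : M = 1%:M) ?det1 //.
by apply/matrixP => k l; rewrite eM mxE.
Qed.

Lemma mxvec_index_inj m n (i i' : 'I_m) (j j' : 'I_n) :
  (mxvec_index i j == mxvec_index i' j') = (i == i') && (j == j').
Proof. by rewrite (inj_eq (@cast_ord_inj _ _ _)) (inj_eq enum_rank_inj). Qed.

Lemma det_cast_split_rows a n :
  det_cast (row_mx (L (row_mx 1%:M 0)) (L (row_mx 0 1%:M)) :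
    'M[K]_((a + a) * n, a * n + a * n)) = 1.
Proof.
apply: det_cast_eq1 => [|k l]; first by rewrite mulnDl.
have -> : forall M : 'M[K]_((a + a) * n, a * n + a * n),
    M k l = ((delta_mx 0 k : 'rV_((a + a) * n)) *m M) 0 l by move=> M; rewrite -rowE [RHS]mxE.
case/mxvec_indexP: k => i j; rewrite -mxvec_delta mul_mx_row !mxvec_lin_mulmx.
rewrite -[delta_mx i j]vsubmxK !mul_row_col !mul1mx !mul0mx addr0 add0r.
rewrite mxE; case: splitP => l' el; case/mxvec_indexP: l' el => i' j' el.
  have -> : (mxvec_index i j == l :> nat) =
            (mxvec_index i j == mxvec_index (lshift a i') j').
    by rewrite -val_eqE el -[nat_of_ord (mxvec_index i' j')]/(val _) !val_mxvec_index.
  by rewrite mxvecE !mxE mxvec_index_inj !(eq_sym i) !(eq_sym j).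
have -> : (mxvec_index i j == l :> nat) =
          (mxvec_index i j == mxvec_index (rshift a i') j').
  rewrite -val_eqE el -[nat_of_ord (mxvec_index i' j')]/(val _) !val_mxvec_index.
  by rewrite /= mulnDl addnA.
by rewrite mxvecE !mxE mxvec_index_inj !(eq_sym i) !(eq_sym j).
Qed.

(** For the standard projections this cuts v into its four blocks. *)
Definition quadrants a e (p : 'M[K]_(a, a + a)) (p' : 'M[K]_(a, a + a))
  (q q' : 'M[K]_(e + e, e)) :=
  row_mx (row_mx (L p *m R q) (L p *m R q')) (row_mx (L p' *m R q) (L p' *m R q')).

(** Cutting the rows preserves the order of the entries. Cutting the columns permutes them, but
    identically in the upper and the lower half, so the sign appears squared. *)
Lemma det_cast_quadrants a e : exists2 c : K, c != 0 &
  det_cast (@quadrants a e (row_mx 1%:M 0) (row_mx 0 1%:M) (col_mx 1%:M 0) (col_mx 0 1%:M)) = c ^+ 2.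
Proof.
pose R' : 'M[K]_(a * (e + e), a * e + a * e) :=
  row_mx (R (col_mx 1%:M 0)) (R (col_mx 0 1%:M)).
have ee : (a * (e + e) = a * e + a * e)%N by rewrite mulnDr.
exists (det_cast R').
  apply: (@det_cast_neq0 _ _ _ (col_mx (R (row_mx 1%:M 0)) (R (row_mx 0 1%:M)))) => //.
  by rewrite mul_row_col !lin_mulmxr_comp -lin_mulmxr_D colrow_split lin_mulmxr_1.
have -> : @quadrants a e (row_mx 1%:M 0) (row_mx 0 1%:M) (col_mx 1%:M 0) (col_mx 0 1%:M) =
    row_mx (L (row_mx 1%:M 0)) (L (row_mx 0 1%:M)) *m block_mx R' 0 0 R'.
  rewrite /quadrants [RHS]mul_row_block ![_ *m 0]mulmx0 addr0 add0r /R'.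
  by congr row_mx; rewrite mul_mx_row.
rewrite det_cast_block ?mulnDl //.
by rewrite det_cast_split_rows mul1r.
Qed.

(** The matrix [xi_mx] written with multiplication operators and free sizes, so that equations
    between sizes can be substituted. *)
Definition xi_gen a e w c (P : 'I_4 -> 'M[K]_(a, w)) (Q : 'I_4 -> 'M[K]_(c, e)) :=
  row_mx (row_mx (L (P (o4 0)) *m R (Q (o4 0))) (L (P (o4 1)) *m R (Q (o4 1))))
         (row_mx (L (P (o4 2)) *m R (Q (o4 2))) (L (P (o4 3)) *m R (Q (o4 3)))).

Lemma xi_mxE a b P Q : @xi_mx K a b P Q = xi_gen P Q.
Proof.
apply/row_matrixP => k; rewrite [RHS]rowE -[delta_mx 0 k in RHS]vec_mxK.
rewrite /xi_gen !mul_mx_row !mulmxA !mxvec_lin_mulmx !mxvec_lin_mulmxr.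
by apply/rowP => l; rewrite [LHS]mxE /xi_mx [LHS]mxE.
Qed.

Lemma det_block_swap3 n :
  exists2 c : K, c != 0 & forall A B C D E F G H : 'M[K]_n,
  \det (block_mx (block_mx 0 0 1%:M 0) (block_mx A B C D)
                 (block_mx 0 1%:M 0 0) (block_mx E F G H)) =
  c ^+ 2 * \det (block_mx A B G H).
Proof.
pose S : 'M[K]_((n + n) + (n + n)) :=
  block_mx (block_mx 0 1%:M 0 0) (block_mx 0 0 1%:M 0)
           (block_mx 1%:M 0 0 0) (block_mx 0 0 0 1%:M).
have S3 : S *m S *m S = 1%:M.
  rewrite /S !(mulmx_block, add_block_mx, mulmx0, mul0mx, mulmx1, mul1mx, addr0, add0r).
  by rewrite !(block_mx0, addr0, add0r) -!scalar_mx_block.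
(* As the 3-cycle [S] has order 3, [(\det S)^-1] is the square of [\det S]. *)
have dS3 : \det S ^+ 3 = 1 by rewrite -(det1 K ((n + n) + (n + n))) -S3 !det_mulmx !exprS mulr1 mulrA.
have dS0 : \det S != 0.
  by apply/eqP => e; move: dS3; rewrite e expr0n => /esym/eqP; rewrite oner_eq0.
exists (\det S) => // A B C D E F G H; set M := block_mx _ _ _ _.
have : S *m M = block_mx 1%:M (block_mx C D E F) 0 (block_mx A B G H).
  rewrite /S /M !(mulmx_block, add_block_mx, mulmx0, mul0mx, mulmx1, mul1mx, addr0, add0r).
  by rewrite !(block_mx0, addr0, add0r) -!scalar_mx_block.
move/(congr1 determinant); rewrite det_mulmx det_ublock det1 mul1r => <-.
by rewrite mulrA -exprSr dS3 mul1r.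
Qed.

(** On blocks v11, v12, v21, v22 the first two components are v12 and v21. With these eliminated,
    the others become v22 - v11 and X v22 - v11 Z, and adding the first block variable to the second
    leaves the Sylvester operator. The remaining sign (-1)^(ae) is 1 as [a] is even. *)
Lemma det_cast_xi_std a e (X : 'M[K]_a) (Z : 'M[K]_e) P Q : ~~ odd a ->
  P (o4 0) = row_mx 1%:M 0 -> P (o4 1) = row_mx 0 1%:M ->
  P (o4 2) = row_mx 1%:M 1%:M -> P (o4 3) = row_mx 1%:M X ->
  Q (o4 0) = col_mx 0 1%:M -> Q (o4 1) = col_mx 1%:M 0 ->
  Q (o4 2) = col_mx (- 1%:M) 1%:M -> Q (o4 3) = col_mx (- Z) 1%:M ->
  exists2 c : K, c != 0 & det_cast (@xi_gen a e _ _ P Q) = c ^+ 2 * sylvester X Z.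
Proof.
move=> eva P0 P1 P2 P3 Q0 Q1 Q2 Q3.
have [c c0 ec] := det_cast_quadrants a e; have [c' c'0 ec'] := det_block_swap3 (a * e).
exists (c * c'); first by rewrite mulf_neq0.
pose M : 'M[K]_((a * e + a * e) + (a * e + a * e)) :=
  block_mx (block_mx 0 0 1%:M 0) (block_mx (- 1%:M) (- R Z) 1%:M 1%:M)
           (block_mx 0 1%:M 0 0) (block_mx (- 1%:M) (- (L X *m R Z)) 1%:M (L X)).
have -> : xi_gen P Q =
    quadrants (row_mx 1%:M 0) (row_mx 0 1%:M) (col_mx 1%:M 0) (col_mx 0 1%:M) *m M.
  rewrite /xi_gen P0 P1 P2 P3 Q0 Q1 Q2 Q3 /quadrants /M.
  set p := row_mx 1%:M 0; set p' := row_mx 0 1%:M.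
  set q := col_mx 1%:M 0; set q' := col_mx 0 1%:M.
  have -> : row_mx 1%:M 1%:M = p + p' by rewrite add_row_mx addr0 add0r.
  have -> : row_mx 1%:M X = p + X *m p'.
    by rewrite mul_mx_row mulmx0 mulmx1 add_row_mx addr0 add0r.
  have -> : col_mx (- 1%:M) 1%:M = q' - q.
    by rewrite opp_col_mx add_col_mx oppr0 addr0 add0r.
  have -> : col_mx (- Z) 1%:M = q' - q *m Z.
    by rewrite mul_col_mx mul1mx mul0mx opp_col_mx add_col_mx oppr0 addr0 add0r.
  rewrite !lin_mulmx_D !lin_mulmxr_D !lin_mulmxr_N -lin_mulmx_comp -lin_mulmxr_comp.
  rewrite !mul_row_block !(mulmx0, mulmx1, addr0, add0r).
  rewrite !add_row_mx !(addr0, add0r) !mulmxN !mulmx1; congr row_mx; congr row_mx.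
    by rewrite mulmxDl !mulmxBr; congr (_ + _); rewrite addrC.
  rewrite mulmxDl !mulmxBr; congr (_ + _); rewrite addrC; congr (_ + _).
  - by rewrite mulmxA.
  - by rewrite -!mulmxA (mulmxA (R q) (L X)) lin_mulmxr_mulmxC -!mulmxA.
  - by rewrite -!mulmxA lin_mulmxr_mulmxC.
rewrite det_castMr; last by rewrite mulnDl !mulnDr.
rewrite ec ec' exprMn -!mulrA; congr (_ * (_ * _)).
have -> : block_mx (- 1%:M) (- R Z) 1%:M (L X) =
    block_mx (-1)%:M 0 1%:M 1%:M *m block_mx 1%:M (R Z) 0 (L X - R Z).
  rewrite mulmx_block !(mulmx0, mul0mx, mulmx1, mul1mx, addr0, add0r).
  by rewrite mul_scalar_mx scaleN1r addrC subrK rmorphN.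
rewrite det_mulmx det_lblock det_ublock !det1 det_scalar mul1r mulr1 /sylvester.
by rewrite -signr_odd oddM (negPf eva) mul1r.
Qed.

End XiMatrix.

(** * Dependence of the matrix on the chosen bases *)

Section XiData.

Variable K : fieldType.
Local Notation L := (@lin_mulmx K _ _ _).
Local Notation R := (@lin_mulmxr K _ _ _).

Definition xi_data a b e w c u (V : 'I_4 -> 'M[K]_(b, u)) (W : 'M_(w, u)) (C : 'M_(c, u))
    (A : 'I_4 -> 'M_(a, u)) (P : 'I_4 -> 'M_(a, w)) (D : 'I_4 -> 'M_(e, u))
    (Q : 'I_4 -> 'M_(c, e)) :=
  [/\ \rank (col_mx W C) = u,
      forall m, [/\ \rank (A m) = a, (A m <= W)%MS, (A m <= V m)%MS & A m = P m *m W],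
      forall m, \rank (col_mx (col_mx (V m) W) (D m)) = u &
      forall m, (C - Q m *m D m <= V m + W)%MS].

Lemma row_free_col m n p (A : 'M[K]_(m, p)) (B : 'M_(n, p)) :
  row_free (col_mx A B) -> row_free A /\ forall x : 'M_n, (x *m B <= A)%MS -> x = 0.
Proof.
move=> rf; have key q (y : 'M_(q, m)) (x : 'M_(q, n)) : y *m A + x *m B = 0 -> y = 0 /\ x = 0.
  rewrite -mul_row_col -(mul0mx _ (col_mx A B)) => /(row_free_inj rf).
  by rewrite -row_mx0 => /eq_row_mx.
split=> [|x /submxP[y e]].
  rewrite -kermx_eq0; apply/eqP.
  by have [] := key _ (kermx A) (0 : 'M_(_, n)); rewrite ?mulmx_ker ?mul0mx ?addr0.
by have [] := key _ (- y) x; rewrite // mulNmx -e addNr.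
Qed.

Lemma quotient_free m n e u (S : 'M[K]_(m, u)) (D : 'M_(e, u)) (x : 'M_(n, e)) :
  (\rank S + e <= \rank (S + D)%MS)%N -> (x *m D <= S)%MS -> x = 0.
Proof.
move=> le xD; have sc := mxrank_sum_cap S D.
have rD := rank_leq_row D.
have rD' : \rank D = e.
  apply/eqP; rewrite eqn_leq rD -(leq_add2l (\rank S)) (leq_trans le) //.
  by rewrite -sc leq_addr.
have capE : (S :&: D)%MS = 0.
  apply/eqP; rewrite -mxrank_eq0 -leqn0 -(leq_add2l (\rank (S + D)%MS)) sc addn0.
  by rewrite rD'.
have : (x *m D <= S :&: D)%MS by rewrite sub_capmx xD submxMl.
rewrite capE submx0 => /eqP; rewrite -(mul0mx _ D) => /row_free_inj -> //.
by rewrite /row_free rD'.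
Qed.

Lemma unit_of_fixing n u (g h : 'M[K]_n) (W : 'M_(n, u)) :
  row_free W -> g *m h *m W = W -> g \in unitmx /\ h \in unitmx.
Proof.
by move=> rf; rewrite -[X in _ = X]mul1mx => /(row_free_inj rf)/mulmx1_unit.
Qed.

(** Two choices differ by invertible matrices: [W] and [W'] are bases of one space, [C] and [C'] are
    bases modulo it, [A m] and [A' m] both span the intersection with [V m] by a rank count, and
    [D m], [D' m] are bases modulo [V m + W]. *)
Lemma xi_data_unique a b e w c u (V : 'I_4 -> 'M[K]_(b, u)) W C A P D Q W' C' A' P' D' Q' :
  w = (a + a)%N -> c = (e + e)%N -> b = (a + e)%N -> u = (b + b)%N ->
  @xi_data a b e w c u V W C A P D Q ->
  @xi_data a b e w c u V W' C' A' P' D' Q' -> (W == W')%MS ->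
  (forall m, \rank (W :&: V m)%MS = a) -> (forall m, \rank (V m) = b) ->
  exists (g : 'M_w) (h : 'M_c) (al : 'I_4 -> 'M_a) (de : 'I_4 -> 'M_e),
  [/\ g \in unitmx, h \in unitmx,
      forall m, P m = al m *m P' m *m g /\ Q m = h *m Q' m *m de m &
      forall m, al m \in unitmx /\ de m \in unitmx].
Proof.
move=> ew ec eb eu [rWC hA hD hQ] [rWC' hA' hD' hQ'] eWW rWV rV.
have wc : (w + c = u)%N by rewrite ew ec eu eb addnACA.
have [|rfW indC] := @row_free_col _ _ _ W C; first by rewrite /row_free rWC wc.
have [|rfW' indC'] := @row_free_col _ _ _ W' C'; first by rewrite /row_free rWC' wc.
have /andP[/submxP[g' eg'] /submxP[g eg]] := eWW.
have [ug _] : g \in unitmx /\ g' \in unitmx.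
  by apply: (unit_of_fixing rfW'); rewrite -mulmxA -eg' -eg.
have [h [k eC]] : exists h k, C = h *m C' + k *m W'.
  have : (C <= col_mx W' C')%MS by rewrite submx_full // /row_full rWC'.
  by case/submxP => M ->; exists (rsubmx M), (lsubmx M); rewrite [RHS]addrC -mul_row_col hsubmxK.
have [h' [k' eC']] : exists h k, C' = h *m C + k *m W.
  have : (C' <= col_mx W C)%MS by rewrite submx_full // /row_full rWC.
  by case/submxP => M ->; exists (rsubmx M), (lsubmx M); rewrite [RHS]addrC -mul_row_col hsubmxK.
have [uh _] : h \in unitmx /\ h' \in unitmx.
  apply: mulmx1_unit; apply/eqP; rewrite eq_sym -subr_eq0; apply/eqP/indC.
  have -> : (1%:M - h *m h') *m C = h *m k' *m W + k *m W'.
    rewrite mulmxBl mul1mx {1}eC {1}eC' mulmxDr !mulmxA.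
    by rewrite [_ - _]addrC !addrA addNr add0r.
  by rewrite addmx_sub ?submxMl // mulmx_sub // eg submxMl.
pose S m := (V m + W)%MS.
have rS m : \rank (S m) = (b + a)%N.
  apply/eqP; rewrite -(eqn_add2r (\rank (V m :&: W)%MS)) mxrank_sum_cap rV.
  by rewrite (eqP rfW) capmxC rWV ew addnA.
have rSD m : \rank (S m + D m)%MS = u.
  by rewrite (adds_eqmx (addsmxE _ _) (eqmx_refl _)) addsmxE hD.
have eS m : (S m :=: V m + W')%MS by apply: adds_eqmx => //; apply/eqmxP.
have rSD' m : \rank (S m + D' m)%MS = u.
  rewrite (adds_eqmx (eS m) (eqmx_refl _)).
  by rewrite (adds_eqmx (addsmxE _ _) (eqmx_refl _)) addsmxE hD'.
have ind (D0 : 'M_(e, u)) m n (x : 'M_(n, e)) : \rank (S m + D0)%MS = u ->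
    (x *m D0 <= S m)%MS -> x = 0.
  by move=> rk; apply: quotient_free; rewrite rk rS eu eb addnA.
have span (D0 M : 'M_(e, u)) m : \rank (S m + D0)%MS = u ->
    exists de : 'M_e, (M - de *m D0 <= S m)%MS.
  move=> rk; have : (M <= S m + D0)%MS by rewrite submx_full // /row_full rk.
  case/sub_addsmxP => [[y de] /= ->]; exists de.
  by rewrite addrK submxMl.
have exD m : exists de : 'M_e, de \in unitmx /\ Q m = h *m Q' m *m de.
  have [de hde] := span (D' m) (D m) m (rSD' m).
  have [de' hde'] := span (D m) (D' m) m (rSD m).
  have [ude _] : de \in unitmx /\ de' \in unitmx.
    apply: mulmx1_unit; apply/eqP; rewrite eq_sym -subr_eq0; apply/eqP.
    apply: (ind (D m) m) => //.
    have -> : (1%:M - de *m de') *m D m =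
        (D m - de *m D' m) + de *m (D' m - de' *m D m).
      by rewrite mulmxBl mul1mx mulmxBr !mulmxA addrA subrK.
    by rewrite addmx_sub // mulmx_sub.
  exists (invmx de); rewrite unitmx_inv; split=> //.
  apply: (canRL (mulmxK ude)); apply/esym/eqP; rewrite -subr_eq0; apply/eqP.
  apply: (ind (D' m) m) => //.
  (* Telescoping through h C', k W' and Q D leaves four terms, each lying in [S m]. *)
  have zm (M : zmodType) (a1 a2 a3 a4 a5 : M) :
      a2 - a5 = - (a1 - a2) + (a1 + a3 - a4) - a3 + (a4 - a5).
    by rewrite opprB !addrA subrK [_ - a4 - a3]addrAC addrK subrK.
  rewrite mulmxBl (zm _ (h *m C') _ (k *m W') (Q m *m D m)) -eC.
  rewrite -!mulmxA -!mulmxBr addmx_sub //.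
    rewrite addmx_sub //.
      rewrite addmx_sub ?hQ // eqmx_opp mulmx_sub //.
      by rewrite eS; apply: hQ'.
    rewrite eqmx_opp mulmx_sub // eS.
    exact: addsmxSr.
  by rewrite mulmx_sub.
have exA m : exists al : 'M_a, al \in unitmx /\ P m = al *m P' m *m g.
  have [rA AW AV eA] := hA m; have [rA' AW' AV' eA'] := hA' m.
  have sub1 (B : 'M_(a, u)) : \rank B = a -> (B <= W)%MS -> (B <= V m)%MS ->
      (W :&: V m <= B)%MS.
    move=> rB BW BV; have le : (B <= W :&: V m)%MS by rewrite sub_capmx BW BV.
    by rewrite -(geq_leqif (mxrank_leqif_sup le)) rB rWV.
  have A'W : (A' m <= W)%MS by rewrite (submx_trans AW') // eg submxMl.
  have /submxP[al eal] : (A m <= A' m)%MS.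
    by rewrite (submx_trans _ (sub1 _ rA' A'W AV')) // sub_capmx AW AV.
  have /submxP[al' eal'] : (A' m <= A m)%MS.
    by rewrite (submx_trans _ (sub1 _ rA AW AV)) // sub_capmx A'W AV'.
  have [ual _] : al \in unitmx /\ al' \in unitmx.
    apply: (unit_of_fixing (W := A m)); first by rewrite /row_free rA.
    by rewrite -mulmxA -eal' -eal.
  exists al; split=> //; apply: (row_free_inj rfW).
  by rewrite -eA eal eA' {1}eg !mulmxA.
have [al hal] := fin_all_exists exA; have [de hde] := fin_all_exists exD.
exists g, h, al, de; split=> // m.
  by have [_ ->] := hal m; have [_ ->] := hde m.
by have [] := hal m; have [] := hde m.
Qed.

End XiData.

Lemma ord4_ind (P : 'I_4 -> Prop) :
  P (o4 0) -> P (o4 1) -> P (o4 2) -> P (o4 3) -> forall m, P m.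
Proof.
move=> P0 P1 P2 P3 m.
have o4E k (lt : (k < 4)%N) : Ordinal lt = o4 k by apply: val_inj; rewrite /= inordK.
by case: m => [[|[|[|[|//]]]] lt]; rewrite o4E.
Qed.

Definition fam4 T (x0 x1 x2 x3 : T) (m : 'I_4) : T :=
  match val m with 0 => x0 | 1 => x1 | 2 => x2 | _ => x3 end.

Lemma fam4E T (x0 x1 x2 x3 : T) :
  (fam4 x0 x1 x2 x3 (o4 0) = x0) * (fam4 x0 x1 x2 x3 (o4 1) = x1) *
  (fam4 x0 x1 x2 x3 (o4 2) = x2) * (fam4 x0 x1 x2 x3 (o4 3) = x3).
Proof. by rewrite /fam4 /o4 /= !inordK. Qed.

(** * Reduction of a balanced point to standard bases *)

Section XiStandard.

Variable K : fieldType.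
Local Notation L := (@lin_mulmx K _ _ _).
Local Notation R := (@lin_mulmxr K _ _ _).

(** Every base change acts on a space of matrices with both sizes even, hence with square
    determinant. *)
Lemma det_cast_xi_change a e i k (P P' : 'I_4 -> 'M[K]_(a, a + a))
    (Q Q' : 'I_4 -> 'M[K]_(e + e, e)) g h al de :
  a = (i + i)%N -> e = (k + k)%N ->
  g \in unitmx -> h \in unitmx ->
  (forall m, P m = al m *m P' m *m g /\ Q m = h *m Q' m *m de m) ->
  (forall m, al m \in unitmx /\ de m \in unitmx) ->
  exists2 c : K, c != 0 & det_cast (xi_gen P Q) = c ^+ 2 * det_cast (xi_gen P' Q').
Proof.
move=> ea ee ug uh ePQ u_al_de.
pose B m := L (al m) *m R (de m) : 'M[K]_(a * e).
have eb m : L (P m) *m R (Q m) = L g *m R h *m (L (P' m) *m R (Q' m)) *m B m.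
  have [-> ->] := ePQ m.
  rewrite /B -!lin_mulmx_comp -!lin_mulmxr_comp -!mulmxA; congr (_ *m _).
  rewrite [in RHS](mulmxA (R h)) lin_mulmxr_mulmxC -!mulmxA; congr (_ *m _).
  rewrite [in RHS](mulmxA (R (Q' m))) lin_mulmxr_mulmxC [in RHS](mulmxA (R h)) [in RHS](mulmxA (R h)).
  by rewrite lin_mulmxr_mulmxC -!mulmxA.
have exB m : exists2 c, c != 0 & \det (B m) = c ^+ 2.
  have [u1 u2] := u_al_de m; rewrite /B det_mulmx.
  have uL := lin_mulmx_unit e u1; have uR := lin_mulmxr_unit a u2.
  move: uL uR; rewrite !unitmxE !unitfE.
  have [c1 ->] : exists c, \det (L (al m) : 'M_(a * e)) = c ^+ 2.
    by move: ee => ->; apply: det_lin_mulmx_double.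
  have [c2 ->] : exists c, \det (R (de m) : 'M_(a * e)) = c ^+ 2.
    by move: ea => ->; apply: det_lin_mulmxr_double.
  rewrite !expf_eq0 /= => c10 c20; exists (c1 * c2); last by rewrite exprMn.
  by rewrite mulf_neq0.
have [c0 [c00 ec0]] : exists c, c != 0 /\ \det (L g *m R h : 'M_((a + a) * (e + e))) = c ^+ 2.
  have uL := lin_mulmx_unit (e + e) ug; have uR := lin_mulmxr_unit (a + a) uh.
  move: uL uR; rewrite !unitmxE !unitfE det_mulmx.
  have [c1 ->] := det_lin_mulmx_double e g; have [c2 ->] := det_lin_mulmxr_double a h.
  rewrite !expf_eq0 /= => c10 c20; exists (c1 * c2).
  by rewrite mulf_neq0 // exprMn.
have [c1 c10 ec1] := exB (o4 0); have [c2 c20 ec2] := exB (o4 1).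
have [c3 c30 ec3] := exB (o4 2); have [c4 c40 ec4] := exB (o4 3).
exists (c0 * (c1 * c2 * (c3 * c4))); first by rewrite !mulf_neq0.
pose D := block_mx (block_mx (B (o4 0)) 0 0 (B (o4 1))) 0 0
                   (block_mx (B (o4 2)) 0 0 (B (o4 3))).
have -> : xi_gen P Q = L g *m R h *m xi_gen P' Q' *m D.
  rewrite /xi_gen /D !eb [in RHS]mul_mx_row !mul_row_block ![_ *m 0]mulmx0 !(addr0, add0r).
  by congr row_mx; rewrite mul_mx_row mul_row_block ![_ *m 0]mulmx0 !(addr0, add0r).
have en : ((a + a) * (e + e) = (a * e + a * e) + (a * e + a * e))%N by rewrite mulnDl !mulnDr.
rewrite det_castMr // det_castMl // ec0 /D !det_ublock ec1 ec2 ec3 ec4.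
by ring.
Qed.

Definition frame b u (V : 'I_4 -> 'M[K]_(b, u)) (e1 e2 : 'M_(b, u)) (phi : 'M_b) :=
  [/\ \rank (col_mx e1 e2) = u, (V (o4 0) == e1)%MS, (V (o4 1) == e2)%MS,
      (V (o4 2) == (e1 + e2)%R)%MS & (V (o4 3) == (e1 + phi *m e2)%R)%MS].

Lemma submx_colu m n p (A : 'M[K]_(m, p)) (B : 'M_(n, p)) : (A <= col_mx A B)%MS.
Proof. by rewrite -addsmxE addsmxSl. Qed.

Lemma submx_cold m n p (A : 'M[K]_(m, p)) (B : 'M_(n, p)) : (B <= col_mx A B)%MS.
Proof. by rewrite -addsmxE addsmxSr. Qed.

Section Frame.

Variables (b u : nat) (V : 'I_4 -> 'M[K]_(b, u)) (e1 e2 : 'M[K]_(b, u)) (phi : 'M[K]_b).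
Hypotheses (hu : u = (b + b)%N) (fr : frame V e1 e2 phi).

Lemma frame_free : row_free (col_mx e1 e2).
Proof. by case: fr => rk _ _ _ _; rewrite /row_free rk hu. Qed.

Lemma frame_inj n (x y x' y' : 'M[K]_(n, b)) :
  x *m e1 + y *m e2 = x' *m e1 + y' *m e2 -> x = x' /\ y = y'.
Proof. by rewrite -!mul_row_col => /(row_free_inj frame_free)/eq_row_mx. Qed.

Lemma frame_rank m n (S : 'M[K]_(m, u)) (S' : 'M[K]_(n, u)) :
  (e1 <= S)%MS -> (e2 <= S)%MS -> (S <= S')%MS -> \rank S' = u.
Proof.
move=> s1 s2 sS; apply/eqP; rewrite eqn_leq rank_leq_col /=.
case: fr => rk _ _ _ _; rewrite -{1}rk; apply: mxrankS.
by rewrite (submx_trans _ sS) // col_mx_sub s1.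
Qed.

Variables (a e : nat) (A : 'M[K]_(a, b)) (B : 'M[K]_(e, b)) (X : 'M[K]_a)
  (Y : 'M[K]_(e, a)) (Z : 'M[K]_e).
Hypothesis ad : adapted phi A B X Y Z.

(* In [U = H + H] the subspace [W = A + A] meets [V_m] in the vectors [(h, 0)],
   [(0, h)], [(h, h)], [(h, h phi)] with [h] in [A]; a complement of [V_m + W] is
   spanned by [(0, B)], except for [m = 1] (counting from 0), where it is spanned
   by [(B, 0)]. *)
Definition std_W := col_mx (A *m e1) (A *m e2).
Definition std_C := col_mx (B *m e1) (B *m e2).
Definition std_P : 'I_4 -> 'M[K]_(a, a + a) :=
  fam4 (row_mx 1%:M 0) (row_mx 0 1%:M) (row_mx 1%:M 1%:M) (row_mx 1%:M X).
Definition std_Q : 'I_4 -> 'M[K]_(e + e, e) :=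
  fam4 (col_mx 0 1%:M) (col_mx 1%:M 0) (col_mx (- 1%:M) 1%:M) (col_mx (- Z) 1%:M).
Definition std_D : 'I_4 -> 'M[K]_(e, u) :=
  fam4 (B *m e2) (B *m e1) (B *m e2) (B *m e2).

Lemma adapted_span n (f : 'M[K]_(b, u)) (S : 'M[K]_(n, u)) :
  (A *m f <= S)%MS -> (B *m f <= S)%MS -> (f <= S)%MS.
Proof.
case: ad => eb rk _ _ sA sB.
have /row_fullP[M eM] : row_full (col_mx A B) by rewrite /row_full rk eb.
rewrite -[f]mul1mx -eM -mulmxA mul_col_mx mulmx_sub //.
by rewrite col_mx_sub sA.
Qed.

Lemma adapted_free : row_free A.
Proof.
case: ad => eb rk _ _.
by have [|] := @row_free_col _ _ _ _ A B; first by rewrite /row_free rk.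
Qed.

Lemma std_PW m : std_P m *m std_W =
  fam4 (A *m e1) (A *m e2) (A *m (e1 + e2)) (A *m (e1 + phi *m e2)) m.
Proof.
rewrite /std_P /std_W; elim/ord4_ind: m; rewrite !fam4E mul_row_col !(mul1mx, mul0mx, addr0, add0r) //.
  by rewrite mulmxDr.
by case: ad => _ _ eA _; rewrite mulmxDr !mulmxA eA.
Qed.

Definition std_V : 'I_4 -> 'M[K]_(b, u) := fam4 e1 e2 (e1 + e2) (e1 + phi *m e2).

Lemma frame_V m : (V m == std_V m)%MS.
Proof. by case: fr => _ f0 f1 f2 f3; elim/ord4_ind: m; rewrite /std_V !fam4E. Qed.

Lemma std_rank m : \rank (std_P m *m std_W) = a.
Proof.
have r1 (x y : 'M[K]_b) : row_free (row_mx x y) -> \rank (A *m (x *m e1 + y *m e2)) = a.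
  move=> rf; rewrite -mul_row_col mulmxA mxrankMfree ?frame_free // mxrankMfree //.
  exact/eqP/adapted_free.
have rf1 (y : 'M[K]_b) : row_free (row_mx 1%:M y).
  apply/row_freeP; exists (col_mx 1%:M 0); by rewrite mul_row_col mulmx0 mulmx1 addr0.
have rf2 : row_free (row_mx (0 : 'M[K]_b) (1%:M : 'M[K]_b)).
  apply/row_freeP; exists (col_mx 0 1%:M); by rewrite mul_row_col mulmx0 mulmx1 add0r.
rewrite std_PW; elim/ord4_ind: m; rewrite !fam4E.
- by have := r1 _ _ (rf1 0); rewrite mul1mx mul0mx addr0.
- by have := r1 _ _ rf2; rewrite mul1mx mul0mx add0r.
- by have := r1 _ _ (rf1 1%:M); rewrite !mul1mx.
- by have := r1 _ _ (rf1 phi); rewrite !mul1mx.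
Qed.

Lemma std_sub m : (std_P m *m std_W <= V m)%MS.
Proof.
rewrite std_PW (eqmxP (frame_V m)); elim/ord4_ind: m; rewrite /std_V !fam4E; exact: submxMl.
Qed.

Lemma std_xi_data :
  xi_data V std_W std_C (fun m => std_P m *m std_W) std_P std_D std_Q.
Proof.
have subA1 n (S : 'M[K]_(n, u)) : (std_W <= S)%MS -> (A *m e1 <= S)%MS.
  by rewrite col_mx_sub => /andP[].
have subA2 n (S : 'M[K]_(n, u)) : (std_W <= S)%MS -> (A *m e2 <= S)%MS.
  by rewrite col_mx_sub => /andP[].
split=> [|m|m|m].
- apply: (frame_rank (S := col_mx std_W std_C)) => //; apply: adapted_span.
  + by apply: subA1; apply: submx_colu.
  + exact: submx_trans (submx_colu _ _) (submx_cold _ _).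
  + by apply: subA2; apply: submx_colu.
  + exact: submx_trans (submx_cold _ _) (submx_cold _ _).
- by split; [exact: std_rank | exact: submxMl | exact: std_sub |].
- have sV : (V m <= col_mx (col_mx (V m) std_W) (std_D m))%MS.
    exact: submx_trans (submx_colu _ _) (submx_colu _ _).
  have sW : (std_W <= col_mx (col_mx (V m) std_W) (std_D m))%MS.
    exact: submx_trans (submx_cold _ _) (submx_colu _ _).
  have sD : (std_D m <= col_mx (col_mx (V m) std_W) (std_D m))%MS.
    exact: submx_cold.
  move: (col_mx _ (std_D m)) sV sW sD => S; rewrite (eqmxP (frame_V m)).
  elim/ord4_ind: m; rewrite /std_V /std_D !fam4E => sV sW sD; apply: (frame_rank (S := S)) => //.
  + by apply: adapted_span; rewrite ?subA2.
  + by apply: adapted_span; rewrite ?subA1.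
  + have s2 : (e2 <= S)%MS by apply: adapted_span; rewrite ?subA2.
    by rewrite -[e1](addrK e2) addmx_sub // eqmx_opp.
  + by apply: adapted_span; rewrite ?subA2.
  + have s2 : (e2 <= S)%MS by apply: adapted_span; rewrite ?subA2.
    by rewrite -[e1](addrK (phi *m e2)) addmx_sub // eqmx_opp mulmx_sub.
  + by apply: adapted_span; rewrite ?subA2.
- have sV := frame_V m; have eB := let: And4 _ _ _ eB := ad in eB.
  have inV (M : 'M[K]_(e, b)) : (M *m std_V m <= V m + std_W)%MS.
    by rewrite mulmx_sub // -(eqmxP sV) addsmxSl.
  have sA2 : (A *m e2 <= V m + std_W)%MS by apply: subA2; apply: addsmxSr.
  move: (V m + std_W)%MS inV sA2 => S; rewrite /std_C /std_Q /std_D /std_V.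
  elim/ord4_ind: m sV => _; rewrite !fam4E mul_col_mx opp_col_mx add_col_mx => inV sA2;
    rewrite col_mx_sub !(mul0mx, mul1mx, subrr, subr0) ?sub0mx ?inV //= andbT.
  + by rewrite mulNmx opprK mul1mx -mulmxDr inV.
  + rewrite mulNmx opprK.
    (* Since B phi = Y A + Z B, the vector (B, Z B) differs from (B, B phi) in [V m] by (0, Y A),
       which is in W. *)
    have -> : B *m e1 + Z *m (B *m e2) = B *m (e1 + phi *m e2) - Y *m (A *m e2).
      by rewrite mulmxDr (mulmxA B) eB mulmxDl -!mulmxA [Y *m _ + _]addrC addrA addrK.
    by rewrite addmx_sub ?inV // eqmx_opp mulmx_sub.
Qed.

Lemma xi_det_sylvester i k w c (W : 'M[K]_(w, u)) C A' P D Q :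
  a = (i + i)%N -> e = (k + k)%N -> w = (a + a)%N -> c = (e + e)%N ->
  (forall m, \rank (V m) = b) -> (W == std_W)%MS ->
  (forall m, \rank (W :&: V m)%MS = a) ->
  @xi_data K a b e w c u V W C A' P D Q ->
  exists2 x : K, x != 0 & det_cast (xi_gen P Q) = x ^+ 2 * sylvester X Z.
Proof.
move=> ea ee ew ec rV eW rWV; subst w c => xiW.
have eb : b = (a + e)%N by case: ad.
have [g [h [al [de [ug uh ePQ uad]]]]] :=
  xi_data_unique (erefl _) (erefl _) eb hu xiW std_xi_data eW rWV rV.
have [x x0 ->] := det_cast_xi_change ea ee ug uh ePQ uad.
have [y y0 ->] : exists2 y, y != 0 & det_cast (xi_gen std_P std_Q) = y ^+ 2 * sylvester X Z.
  apply: det_cast_xi_std; rewrite /std_P /std_Q ?fam4E //.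
  by rewrite ea addnn odd_double.
by exists (x * y); rewrite ?mulf_neq0 // exprMn mulrA.
Qed.

Lemma std_xi_data_cast w c : w = (a + a)%N -> c = (e + e)%N ->
  exists (W : 'M[K]_(w, u)) C A' P D Q,
    (W == std_W)%MS /\ @xi_data K a b e w c u V W C A' P D Q.
Proof.
move=> ew ec; subst w c.
exists std_W, std_C, (fun m => std_P m *m std_W), std_P, std_D, std_Q.
by split; [rewrite submx_refl | exact: std_xi_data].
Qed.

End Frame.

End XiStandard.

(** * Balanced subspaces *)

Section Balanced.

Variable K : fieldType.

Lemma o4_neq k k' : (k < 4)%N -> (k' < 4)%N -> k != k' -> o4 k != o4 k'.
Proof. by move=> lk lk' ne; rewrite -val_eqE /= !inordK. Qed.

Lemma frame_exists b u (V : 'I_4 -> 'M[K]_(b, u)) : u = (b + b)%N ->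
  (forall m m', m != m' -> \rank (col_mx (V m) (V m')) = u) ->
  exists e1 e2 phi, frame V e1 e2 phi.
Proof.
move=> hu hV.
have rf m m' : m != m' -> row_free (col_mx (V m) (V m')).
  by move=> ne; rewrite /row_free hV ?hu.
have dec m : exists x y, V m = x *m V (o4 0) + y *m V (o4 1).
  have : (V m <= col_mx (V (o4 0)) (V (o4 1)))%MS.
    by rewrite submx_full // /row_full hV // o4_neq.
  by case/submxP => M ->; exists (lsubmx M), (rsubmx M); rewrite -mul_row_col hsubmxK.
have unit_of (m m' : 'I_4) (x : 'M[K]_b) (y : 'M[K]_b) (T : 'M[K]_(b, u)) :
    row_free (col_mx (V m') (V m)) -> V m = x *m T + y *m V m' -> x \in unitmx.
  move=> f e; rewrite -row_free_unit -kermx_eq0; apply/eqP.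
  have [_] := row_free_col f; apply.
  by rewrite e mulmxDr mulmxA mulmx_ker mul0mx add0r mulmxA submxMl.
have [x2 [y2 d2]] := dec (o4 2); have [x3 [y3 d3]] := dec (o4 3).
have ux2 : x2 \in unitmx by apply: unit_of d2; apply: rf; apply: o4_neq.
have ux3 : x3 \in unitmx by apply: unit_of d3; apply: rf; apply: o4_neq.
have uy2 : y2 \in unitmx by move: d2; rewrite addrC; apply: unit_of; apply: rf; apply: o4_neq.
have eqU (x : 'M[K]_b) (T : 'M[K]_(b, u)) : x \in unitmx -> (x *m T :=: T)%MS.
  by move=> ux; apply: eqmxMfull; rewrite row_full_unit.
(* Rescaling the basis of the last subspace by [z] makes its first coordinate the chosen [e1]; phi
   is then its second coordinate in terms of [e2]. *)
pose z := x3 *m invmx x2.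
have uz : z \in unitmx by rewrite unitmx_mul ux3 unitmx_inv.
exists (x2 *m V (o4 0)), (y2 *m V (o4 1)), (invmx z *m y3 *m invmx y2).
split.
- have h : \rank (col_mx (V (o4 0)) (V (o4 1))) = u by apply: hV; apply: o4_neq.
  by rewrite -addsmxE (adds_eqmx (eqU _ _ ux2) (eqU _ _ uy2)) addsmxE.
- by apply/eqmxP; apply: eqmx_sym; apply: eqU.
- by apply/eqmxP; apply: eqmx_sym; apply: eqU.
- by rewrite d2 submx_refl.
- have <- : z *m (x2 *m V (o4 0) + invmx z *m y3 *m invmx y2 *m (y2 *m V (o4 1))) = V (o4 3).
    rewrite d3 mulmxDr !mulmxA /z mulmxKV // -/z; congr (_ + _ *m _).
    by rewrite mulmxV // mul1mx mulmxKV.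
  by apply/eqmxP; apply: eqU.
Qed.

Variables (a b w u : nat) (V : 'I_4 -> 'M[K]_(b, u)) (e1 e2 : 'M[K]_(b, u)) (phi : 'M[K]_b).
Hypotheses (hu : u = (b + b)%N) (hw : w = (a + a)%N) (fr : frame V e1 e2 phi).

(** The intersections with the first two subspaces are independent of dimension a, so W is Y0 + Y1.
    A vector (h, h) of W has h in both, and the dimension a of the third intersection forces Y0 =
    Y1. In the fourth, h runs through all of Y0 and h phi lies in Y1, which is invariance. *)
Lemma balanced_invariant (W : 'M[K]_(w, u)) :
  \rank W = w -> (forall m, \rank (W :&: V m)%MS = a) ->
  exists A : 'M[K]_(a, b),
    [/\ \rank A = a, (A *m phi <= A)%MS & (W == std_W e1 e2 A)%MS].
Proof.
move=> rW rWV.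
have frf := frame_free hu fr.
have ex m : exists Y : 'M[K]_(u, b),
    \rank Y = a /\ (W :&: V m :=: Y *m std_V e1 e2 phi m)%MS.
  have : (W :&: V m <= std_V e1 e2 phi m)%MS.
    by rewrite -(eqmxP (frame_V fr m)) capmxSr.
  case/submxP => Y eY; exists Y; split; last by rewrite eY.
  have : \rank (std_V e1 e2 phi m) = b.
    have rf1 (x y : 'M[K]_b) : row_free (row_mx x y) -> \rank (x *m e1 + y *m e2)%R = b.
      by move=> rf; rewrite -mul_row_col mxrankMfree //; apply/eqP.
    have rf2 (y : 'M[K]_b) : row_free (row_mx 1%:M y).
      apply/row_freeP; exists (col_mx 1%:M 0); by rewrite mul_row_col mulmx0 mulmx1 addr0.
    have rf3 : row_free (row_mx (0 : 'M[K]_b) (1%:M : 'M[K]_b)).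
      apply/row_freeP; exists (col_mx 0 1%:M); by rewrite mul_row_col mulmx0 mulmx1 add0r.
    rewrite /std_V; elim/ord4_ind: m {Y eY}; rewrite !fam4E.
    - by have := rf1 _ _ (rf2 0); rewrite mul1mx mul0mx addr0.
    - by have := rf1 _ _ rf3; rewrite mul1mx mul0mx add0r.
    - by have := rf1 _ _ (rf2 1%:M); rewrite !mul1mx.
    - by have := rf1 _ _ (rf2 phi); rewrite !mul1mx.
  by move=> rV; rewrite -(rWV m) eY mxrankMfree // /row_free rV.
have [Y0 [r0 E0]] := ex (o4 0); have [Y1 [r1 E1]] := ex (o4 1).
have [Y2 [r2 E2]] := ex (o4 2); have [Y3 [r3 E3]] := ex (o4 3).
rewrite /std_V fam4E in E0; rewrite /std_V fam4E in E1.
rewrite /std_V fam4E in E2; rewrite /std_V fam4E in E3.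
have sub01 : (col_mx (Y0 *m e1) (Y1 *m e2) <= W)%MS.
  by rewrite col_mx_sub -E0 -E1 !capmxSl.
have rk01 : \rank (col_mx (Y0 *m e1) (Y1 *m e2)) = w.
  have -> : col_mx (Y0 *m e1) (Y1 *m e2) = block_mx Y0 0 0 Y1 *m col_mx e1 e2.
    by rewrite mul_block_col !mul0mx addr0 add0r.
  by rewrite mxrankMfree // rank_diag_block_mx r0 r1 hw.
have sub10 : (W <= col_mx (Y0 *m e1) (Y1 *m e2))%MS.
  by rewrite -(geq_leqif (mxrank_leqif_sup sub01)) rk01 rW.
have coord (x y : 'M[K]_(u, b)) : ((x *m e1 + y *m e2)%R <= W)%MS ->
    (x <= Y0)%MS /\ (y <= Y1)%MS.
  move=> xy; have /submxP[M] := submx_trans xy sub10.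
  rewrite -[M]hsubmxK mul_row_col !mulmxA => /(frame_inj hu fr)[-> ->].
  by rewrite !submxMl.
have [s20 s21] : (Y2 <= Y0)%MS /\ (Y2 <= Y1)%MS.
  by apply: coord; rewrite -mulmxDr -E2 capmxSl.
have [s30 s31] : (Y3 <= Y0)%MS /\ (Y3 *m phi <= Y1)%MS.
  by apply: coord; rewrite -mulmxA -mulmxDr -E3 capmxSl.
have geq (S S' : 'M[K]_(u, b)) : \rank S = a -> \rank S' = a -> (S <= S')%MS -> (S' <= S)%MS.
  by move=> rS rS' le; rewrite -(geq_leqif (mxrank_leqif_sup le)) rS rS'.
have s10 : (Y1 <= Y0)%MS := submx_trans (geq _ _ r2 r1 s21) s20.
have s01 : (Y0 <= Y1)%MS := geq _ _ r1 r0 s10.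
pose A := castmx (r0, erefl) (row_base Y0).
have eA : (A :=: Y0)%MS := eqmx_trans (eqmx_cast _ _) (eq_row_base _).
exists A; split.
- by rewrite eA.
- rewrite (eqmxMr phi eA) eA (submx_trans _ s10) //.
  by rewrite (submx_trans _ s31) // submxMr // (geq _ _ r3 r0).
- have E : (std_W e1 e2 A :=: col_mx (Y0 *m e1) (Y1 *m e2))%MS.
    apply: eqmx_trans (eqmx_sym (addsmxE _ _)) (eqmx_trans _ (addsmxE _ _)).
    apply: adds_eqmx; first exact: eqmxMr.
    apply: eqmx_trans (eqmxMr _ eA) _; apply/eqmxP.
    by rewrite !submxMr.
  by rewrite !E sub10.
Qed.

(** The standard vectors give dimension at least a. The intersections with two different [V m] are
    independent inside W, of dimension 2a, so none can be larger. *)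
Lemma invariant_balanced e (A : 'M[K]_(a, b)) (B : 'M_(e, b)) X Y Z (W : 'M[K]_(w, u)) :
  (forall m m', m != m' -> \rank (col_mx (V m) (V m')) = u) ->
  (forall m, \rank (V m) = b) ->
  adapted phi A B X Y Z -> (W == std_W e1 e2 A)%MS ->
  \rank W = w /\ forall m, \rank (W :&: V m)%MS = a.
Proof.
move=> hV rV ad eW.
have rWs : \rank W = w.
  rewrite (eqmxP eW).
  have -> : std_W e1 e2 A = block_mx A 0 0 A *m col_mx e1 e2.
    by rewrite mul_block_col !mul0mx addr0 add0r.
  rewrite mxrankMfree ?(frame_free hu fr) // rank_diag_block_mx hw.
  by rewrite (eqP (adapted_free ad)).
have ge m : (a <= \rank (W :&: V m)%MS)%N.
  rewrite -{1}(std_rank hu fr ad m); apply: mxrankS.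
  by rewrite sub_capmx (std_sub fr ad) (eqmxP eW) submxMl.
split=> // m; apply/eqP; rewrite eqn_leq ge andbT.
have [m' ne] : exists m', m != m'.
  have [->|ne] := eqVneq m (o4 0); last by exists (o4 0).
  by exists (o4 1); apply: o4_neq.
rewrite -(leq_add2r (\rank (W :&: V m')%MS)) -mxrank_sum_cap.
have -> : \rank ((W :&: V m) :&: (W :&: V m'))%MS = 0%N.
  apply/eqP; rewrite -leqn0.
  have cap0 : \rank (V m :&: V m')%MS = 0%N.
    apply/eqP; rewrite -(eqn_add2l (\rank (V m + V m')%MS)) mxrank_sum_cap addn0.
    by rewrite addsmxE hV // !rV hu.
  by rewrite -cap0; apply: mxrankS; apply: capmxS; apply: capmxSr.
rewrite addn0 (leq_trans (_ : _ <= w)%N) //.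
  apply: leq_trans (rank_leq_row W); apply: mxrankS.
  by rewrite addsmx_sub !capmxSl.
by apply: leq_trans (_ : a + a <= _)%N; rewrite ?leq_add2l // -hw.
Qed.

End Balanced.

Lemma frame_map (K K' : fieldType) (f : {rmorphism K -> K'}) b u
    (V : 'I_4 -> 'M[K]_(b, u)) e1 e2 phi :
  frame V e1 e2 phi ->
  frame (fun m => map_mx f (V m)) (map_mx f e1) (map_mx f e2) (map_mx f phi).
Proof.
by case=> rk f0 f1 f2 f3; split; rewrite -?map_col_mx ?mxrank_map -?map_mxM -?map_mxD ?map_submx.
Qed.

Lemma perm_eq_not_uniq (T : eqType) (zs : seq T) : ~~ uniq zs ->
  exists s rest, perm_eq zs [:: s, s & rest].
Proof.
elim: zs => // x zs IH /=; rewrite negb_and negbK.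
have [xz _|_ /= /IH[s [rest ps]]] := boolP (x \in zs).
  by exists x, (rem x zs); rewrite perm_cons perm_to_rem.
exists s, (x :: rest).
apply: perm_trans (_ : perm_eq _ (x :: [:: s, s & rest])) _; first by rewrite perm_cons.
apply/seq.permP => p /=; by rewrite addnCA [in RHS]addnCA (addnCA (p s)).
Qed.

Section Factor.

Variable K : fieldType.

Lemma std_W_eqmx a b u (e1 e2 : 'M[K]_(b, u)) (A A' : 'M_(a, b)) :
  (A :=: A')%MS -> (std_W e1 e2 A :=: std_W e1 e2 A')%MS.
Proof.
move=> eA; apply: eqmx_trans (eqmx_sym (addsmxE _ _)) (eqmx_trans _ (addsmxE _ _)).
by apply: adds_eqmx; apply: eqmxMr.
Qed.

Lemma std_W_sub a b u (V : 'I_4 -> 'M[K]_(b, u)) (e1 e2 : 'M[K]_(b, u)) phi (A A' : 'M_(a, b)) :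
  u = (b + b)%N -> frame V e1 e2 phi ->
  (std_W e1 e2 A <= std_W e1 e2 A')%MS -> (A <= A')%MS.
Proof.
move=> hu fr; rewrite col_mx_sub => /andP[/submxP[M]] + _.
rewrite -[M]hsubmxK mul_row_col !mulmxA => e.
have [|-> _] := @frame_inj _ _ _ _ _ _ _ hu fr _ A 0 (lsubmx M *m A') (rsubmx M *m A').
  by rewrite mul0mx addr0.
exact: submxMl.
Qed.

Lemma same_invariant_char_poly a b (phi : 'M[K]_b) (A A' : 'M_(a, b)) (X X' : 'M_a) :
  row_free A -> (A == A')%MS -> A *m phi = X *m A -> A' *m phi = X' *m A' ->
  char_poly X = char_poly X'.
Proof.
move=> rf /andP[/submxP[g eg] /submxP[g' eg']] eX eX'.
have [_ ug'] : g \in unitmx /\ g' \in unitmx.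
  by apply: (unit_of_fixing rf); rewrite -mulmxA -eg' -eg.
apply: (char_poly_similar (P := g')) => //; apply: (row_free_inj rf).
by rewrite -!mulmxA -eX -eg' -eX' mulmxA -eg'.
Qed.

Lemma factor_adapted a e b (phi : 'M[K]_b) (xs : seq K) (r : {poly K}) :
  b = (a + e)%N -> size xs = a ->
  char_poly phi = (\prod_(x <- xs) ('X - x%:P)) * r ->
  exists A B X Y Z, @adapted K a e b phi A B X Y Z /\
    char_poly X = \prod_(x <- xs) ('X - x%:P).
Proof.
move=> eb sx; subst a b => ephi.
have [A [X [rA eA eX]]] := triangular_sub ephi.
have [|B [X' [Y [Z ad]]]] := @adapted_exists K _ e _ phi A (erefl _) rA.
  by rewrite eA submxMl.
exists A, B, X', Y, Z; split=> //; rewrite -eX.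
apply: (@same_invariant_char_poly _ _ phi A A) => //; first exact: adapted_free ad.
  by rewrite submx_refl.
by case: ad.
Qed.

Lemma sylvester_prod_cast a e (X : 'M[K]_a) (Z : 'M[K]_e) xs ys :
  size xs = a -> char_poly X = \prod_(x <- xs) ('X - x%:P) ->
  char_poly Z = \prod_(y <- ys) ('X - y%:P) ->
  sylvester X Z = \prod_(x <- xs) \prod_(y <- ys) (x - y).
Proof.
move=> sx; subst a => eX eZ; rewrite (sylvester_prod _ eX) eZ.
apply: eq_bigr => x _; rewrite horner_prod.
by apply: eq_bigr => y _; rewrite hornerXsubC.
Qed.

End Factor.

(** * Balanced points over extensions and factors of chi *)

Section Points.

Variables (F : fieldType) (i j : nat).
Local Notation a := (2 * i)%N.
Local Notation b := (2 * j)%N.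
Local Notation e := (b - a)%N.
Hypotheses (i_gt0 : (0 < i)%N) (hij : (a < b)%N).
Variable V : 'I_4 -> 'M[F]_(b, 2 * b).
Hypotheses (hV : forall m, \rank (V m) = b) (hgp : gen_pos a b V).
Variables (e1 e2 : 'M[F]_(b, 2 * b)) (phi : 'M[F]_b).
Hypothesis fr : frame V e1 e2 phi.

Let chi := char_poly phi.
Let hu : (2 * b = b + b)%N. Proof. by rewrite mul2n addnn. Qed.
Let hw : (2 * a = a + a)%N. Proof. by rewrite mul2n addnn. Qed.
Let hb : (b = a + e)%N. Proof. by rewrite subnKC // ltnW. Qed.
Let hc : (2 * b - 2 * a = e + e)%N. Proof. by rewrite -mulnBr mul2n addnn. Qed.
Let ha2 : (a = i + i)%N. Proof. by rewrite mul2n addnn. Qed.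
Let hb2 : (b = j + j)%N. Proof. by rewrite mul2n addnn. Qed.
Let he2 : (e = (j - i) + (j - i))%N. Proof. by rewrite -mulnBr mul2n addnn. Qed.

Definition point_data (L : fieldExtType F) (W : 'M[L]_(2 * a, 2 * b))
    (A : 'M[L]_(a, b)) (B : 'M[L]_(e, b)) X Y Z :=
  adapted (map_mx (in_alg L) phi) A B X Y Z /\
  (W == std_W (map_mx (in_alg L) e1) (map_mx (in_alg L) e2) A)%MS.

Lemma frame_L (L : fieldExtType F) : frame (base_change L V)
  (map_mx (in_alg L) e1) (map_mx (in_alg L) e2) (map_mx (in_alg L) phi).
Proof. exact: (frame_map (in_alg L) fr). Qed.

Lemma rank_base_change (L : fieldExtType F) m : \rank (base_change L V m) = b.
Proof. by rewrite -[RHS](hV m) -(mxrank_map (in_alg L)). Qed.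

Lemma pair_base_change (L : fieldExtType F) m m' : m != m' ->
  \rank (col_mx (base_change L V m) (base_change L V m')) = (2 * b)%N.
Proof.
move=> ne; rewrite -[RHS]((proj1 hgp) m m' ne) -(mxrank_map (in_alg L)).
by rewrite map_col_mx.
Qed.

Lemma char_poly_L (L : fieldExtType F) :
  char_poly (map_mx (in_alg L) phi) = map_poly (in_alg L) chi.
Proof. by rewrite map_char_poly. Qed.

Lemma balanced_point_data (L : fieldExtType F) (W : 'M[L]_(2 * a, 2 * b)) :
  balanced (base_change L V) W -> exists A B X Y Z, point_data W A B X Y Z.
Proof.
move=> [rW rWV].
have [A [rA sA eW]] := balanced_invariant hu hw (frame_L L) rW rWV.
have [B [X [Y [Z ad]]]] := adapted_exists hb rA sA.
by exists A, B, X, Y, Z.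
Qed.

Lemma point_data_balanced (L : fieldExtType F) (W : 'M[L]_(2 * a, 2 * b)) A B X Y Z :
  point_data W A B X Y Z -> balanced (base_change L V) W.
Proof.
case=> ad eW.
have H1 := invariant_balanced hu hw (frame_L L).
have H2 := H1 _ _ _ _ _ _ W (@pair_base_change L).
exact: H2 (rank_base_change L) ad eW.
Qed.

Lemma point_data_det (L : fieldExtType F) (W : 'M[L]_(2 * a, 2 * b)) A B X Y Z d :
  point_data W A B X Y Z -> xi_det_rep (base_change L V) W d ->
  exists2 x, x != 0 & d = x ^+ 2 * sylvester X Z.
Proof.
move=> pd [C [A' [P [D [Q [h1 h2 h3 h4 ->]]]]]]; have [_ bal] := point_data_balanced pd.
case: pd => ad eW; rewrite xi_mxE.
have H := xi_det_sylvester hu (frame_L L) ad ha2 he2 hw hc (rank_base_change L) eW bal.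
exact: H (And4 h1 h2 h3 h4).
Qed.

(** Each split factorisation of chi is realised by a balanced point over [L], where general position
    makes the resultant nonzero. *)
Lemma factor_point (L : fieldExtType F) (xs ys : seq L) : size xs = a ->
  map_poly (in_alg L) chi =
    (\prod_(x <- xs) ('X - x%:P)) * (\prod_(y <- ys) ('X - y%:P)) ->
  exists W A B X Y Z,
  [/\ @point_data L W A B X Y Z, char_poly X = \prod_(x <- xs) ('X - x%:P),
      char_poly Z = \prod_(y <- ys) ('X - y%:P) & sylvester X Z != 0].
Proof.
move=> sx; rewrite -char_poly_L => ephi.
have [A [B [X [Y [Z [ad eX]]]]]] := factor_adapted hb sx ephi.
have [W [C [A' [P [D [Q [eW xiW]]]]]]] :=
  std_xi_data_cast hu (frame_L L) ad hw hc.
have pd : point_data W A B X Y Z by [].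
exists W, A, B, X, Y, Z; split=> //.
  have := adapted_char_poly ad; rewrite ephi eX.
  by move/(mulfI (monic_neq0 (monic_prod_XsubC _ _ _))).
case: xiW => h1 h2 h3 h4.
have hd : xi_det_rep (base_change L V) W
  (\det (conform_mx (0 : 'M[L]_(2 * a * (2 * b - 2 * a))) (xi_mx P Q))).
  by exists C, A', P, D, Q.
have := (proj2 hgp) L W (point_data_balanced pd) _ hd.
have [x x0 ->] := point_data_det pd hd.
by rewrite mulf_eq0 negb_or => /andP[].
Qed.

Lemma chi_monic : chi \is monic. Proof. exact: char_poly_monic. Qed.
Lemma chi_size : size chi = b.+1. Proof. exact: size_char_poly. Qed.

Lemma chi_separable : separable_poly chi.
Proof.
have [L [zs ezs]] := splitting_field (monic_neq0 chi_monic).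
have {}ezs : map_poly (in_alg L) chi = \prod_(z <- zs) ('X - z%:P).
  apply/eqP; rewrite -eqp_monic ?monic_prod_XsubC //.
  by rewrite monic_map ?chi_monic.
rewrite -(separable_map (in_alg L)) ezs separable_prod_XsubC.
apply: contraT => /perm_eq_not_uniq[s [rest ps]].
have szr : size rest = (b - 2)%N.
  have := congr1 (fun p : {poly L} => size p) ezs.
  rewrite size_map_poly chi_size size_prod_XsubC (perm_size ps) /= => -[->].
  by rewrite subn2.
have a1 : (0 < a)%N by rewrite muln_gt0.
(* The double root [s] is given to both factors; this is possible because 0 < a < b. *)
pose xs := s :: take a.-1 rest; pose ys := s :: drop a.-1 rest.
have sx : size xs = a.
  rewrite /= size_takel ?prednK // szr.
  move: a1 hij; case: (2 * i)%N => // m _; case: (2 * j)%N => [|[|n]] //=.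
  by rewrite subn2 /= !ltnS.
have exy : map_poly (in_alg L) chi =
    (\prod_(x <- xs) ('X - x%:P)) * (\prod_(y <- ys) ('X - y%:P)).
  rewrite ezs (perm_big _ ps) !big_cons -[in LHS](cat_take_drop a.-1 rest) big_cat /=.
  by ring.
have [W [A [B [X [Y [Z [_ eX eZ]]]]]]] := factor_point sx exy.
by rewrite (sylvester_prod_cast sx eX eZ) !big_cons subrr !mul0r eqxx.
Qed.

Lemma point_data_kernel (L : fieldExtType F) (W : 'M[L]_(2 * a, 2 * b)) A B X Y Z :
  point_data W A B X Y Z -> (A :=: kermxpoly (map_mx (in_alg L) phi) (char_poly X))%MS.
Proof.
case=> ad _; apply: (adapted_kernel ad).
have : separable_poly (map_poly (in_alg L) chi) by rewrite separable_map chi_separable.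
by rewrite -char_poly_L (adapted_char_poly ad) separable_mul => /and3P[].
Qed.

Section ClosedPoints.

Variables (N : nat) (E : 'I_N -> fieldExtType F)
  (W : forall k, 'M[E k]_(2 * a, 2 * b)) (d : forall k, E k).
Arguments W : clear implicits.
Arguments d : clear implicits.
Hypotheses (hW : closed_point_system a b V E W)
  (hd : forall k, xi_det_rep (base_change (E k) V) (W k) (d k)).

Definition factor_of k (q : {poly E k}) :=
  exists A B X Y Z, point_data (W k) A B X Y Z /\ q = char_poly X.

Lemma factor_of_exists k : exists q : {poly E k}, factor_of q.
Proof.
case: hW => bal _ _ _; have [A [B [X [Y [Z pd]]]]] := balanced_point_data (bal k).
by exists (char_poly X), A, B, X, Y, Z.
Qed.

(** The kernel of q(phi) can be computed over the field of coefficients of q, so [W k] is defined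
    there. *)
Lemma factor_of_defined k (q : {poly E k}) (S : {subfield E k}) :
  factor_of q -> q \is a polyOver S -> S = fullv :> {vspace E k}.
Proof.
move=> [A [B [X [Y [Z [pd ->]]]]]] /polyOver_subvs[q' eq'].
case: hW => _ hdef _ _; apply: hdef.
pose f := in_alg (subvs_of S).
pose g : {rmorphism subvs_of S -> E k} := vsval.
have gf m n (M : 'M[F]_(m, n)) : map_mx g (map_mx f M) = map_mx (in_alg (E k)) M.
  rewrite -map_mx_comp; apply: eq_map_mx => x.
  by rewrite -[LHS]/(x *: algid S) algid1.
pose K' := kermxpoly (map_mx f phi) q'.
have eK' : map_mx g K' = kermxpoly (map_mx (in_alg (E k)) phi) (char_poly X).
  by rewrite map_kermxpoly gf eq'.
have kerA := point_data_kernel pd.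
have [ad eW] := pd.
have rK' : \rank K' = a.
  by rewrite -(mxrank_map g) eK' -kerA; apply/eqP; apply: adapted_free ad.
pose A' := castmx (rK', erefl) (row_base K').
have eA' : (map_mx g A' :=: A)%MS.
  apply/eqmxP; rewrite !kerA -eK' !map_submx; apply/eqmxP.
  exact: eqmx_trans (eqmx_cast _ _) (eq_row_base _).
pose M := castmx (esym hw, erefl) (std_W (map_mx f e1) (map_mx f e2) A').
exists (map_mx g M); split=> [r s|]; first by rewrite mxE; apply: subvsP.
have eM : (map_mx g M :=: std_W (map_mx (in_alg (E k)) e1) (map_mx (in_alg (E k)) e2) A)%MS.
  apply: eqmx_trans (std_W_eqmx _ _ eA').
  rewrite /M map_castmx; apply: eqmx_trans (eqmx_cast _ _) _.
  by rewrite map_col_mx !map_mxM !gf.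
by rewrite !eM andbC.
Qed.

(** The factor [p] comes from a balanced point over [L], which completeness of the list matches with
    an embedded [W k]; equal subspaces have equal characteristic polynomials. *)
Lemma factor_of_all (q : forall k, {poly E k}) : (forall k, factor_of (q k)) ->
  forall (L : fieldExtType F) (p : {poly L}) (zs : seq L),
    map_poly (in_alg L) chi = \prod_(z <- zs) ('X - z%:P) ->
    p \is monic -> size p = a.+1 -> p %| map_poly (in_alg L) chi ->
    exists k, exists s : 'AHom(E k, L), map_poly s (q k) = p.
Proof.
move=> hq L p zs ezs mp sp dv.
have split (r : {poly L}) : r \is monic -> r %| \prod_(z <- zs) ('X - z%:P) ->
    exists xs : seq L, r = \prod_(x <- xs) ('X - x%:P).
  move=> mr /dvdp_prod_XsubC[m em]; exists (mask m zs).
  by apply/eqP; rewrite -eqp_monic ?monic_prod_XsubC.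
have [xs exs] : exists xs : seq L, p = \prod_(x <- xs) ('X - x%:P).
  by apply: split; rewrite -?ezs.
have [r er] := dvdpP _ _ dv.
have mr : r \is monic by rewrite -(monicMr r mp) -er monic_map ?chi_monic.
have [ys eys] : exists ys : seq L, r = \prod_(y <- ys) ('X - y%:P).
  by apply: split; rewrite // -ezs er dvdp_mulr.
have sx : size xs = a by apply/succn_inj; rewrite -sp exs size_prod_XsubC.
have exy : map_poly (in_alg L) chi =
    (\prod_(x <- xs) ('X - x%:P)) * (\prod_(y <- ys) ('X - y%:P)).
  by rewrite er mulrC exs eys.
have [W' [A [B [X [Y [Z [pd eX _ _]]]]]]] := factor_point sx exy.
case: hW => _ _ hall _; have [k [s sW]] := hall L W' (point_data_balanced pd).
exists k, s; have [A1 [B1 [X1 [Y1 [Z1 [[ad1 eW1] ->]]]]]] := hq k.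
rewrite map_char_poly exs -eX; have [ad eW] := pd.
have gf m n (M : 'M[F]_(m, n)) : map_mx s (map_mx (in_alg (E k)) M) = map_mx (in_alg L) M.
  by rewrite -map_mx_comp; apply: eq_map_mx => x; rewrite /= ahom_alg.
have eW1' : (map_mx s (W k) == std_W (map_mx (in_alg L) e1) (map_mx (in_alg L) e2) (map_mx s A1))%MS.
  have -> : std_W (map_mx (in_alg L) e1) (map_mx (in_alg L) e2) (map_mx s A1) =
      map_mx s (std_W (map_mx (in_alg (E k)) e1) (map_mx (in_alg (E k)) e2) A1).
    by rewrite map_col_mx !map_mxM !gf.
  by rewrite !map_submx.
have eWW : (std_W (map_mx (in_alg L) e1) (map_mx (in_alg L) e2) (map_mx s A1) ==
            std_W (map_mx (in_alg L) e1) (map_mx (in_alg L) e2) A)%MS.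
  by rewrite -!(eqmxP eW1') -!(eqmxP eW); exact: sW.
have eAA : (map_mx s A1 == A)%MS.
  case/andP: eWW => w1 w2.
  by rewrite (std_W_sub hu (frame_L L) w1) (std_W_sub hu (frame_L L) w2).
apply: (same_invariant_char_poly _ eAA).
- rewrite /row_free mxrank_map; exact: adapted_free ad1.
- by case: ad1 => _ _ eA1 _; rewrite -map_mxM -eA1 map_mxM gf.
- by case: ad.
Qed.

(** The subspace is the kernel attached to its polynomial, so equal polynomials give the same closed
    point. *)
Lemma factor_of_distinct k k' (q : {poly E k}) (q' : {poly E k'}) (s : 'AHom(E k, E k')) :
  factor_of q -> factor_of q' -> map_poly s q = q' -> k = k'.
Proof.
move=> [A [B [X [Y [Z [pd ->]]]]]] [A' [B' [X' [Y' [Z' [pd' ->]]]]]] eq.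
case: hW => _ _ _ hdist; apply: (hdist k k' s).
have gf m n (M : 'M[F]_(m, n)) :
    map_mx s (map_mx (in_alg (E k)) M) = map_mx (in_alg (E k')) M.
  by rewrite -map_mx_comp; apply: eq_map_mx => x; rewrite /= ahom_alg.
have eA : (map_mx s A :=: A')%MS.
  apply: eqmx_trans (eqmx_sym (point_data_kernel pd')).
  rewrite -eq -gf -map_kermxpoly; apply/eqmxP.
  by rewrite !map_submx; apply/eqmxP; apply: point_data_kernel pd.
have [ad eW] := pd; have [ad' eW'] := pd'.
have eWm : (map_mx s (W k) :=: std_W (map_mx (in_alg (E k')) e1)
    (map_mx (in_alg (E k')) e2) (map_mx s A))%MS.
  apply/eqmxP.
  have -> : std_W (map_mx (in_alg (E k')) e1) (map_mx (in_alg (E k')) e2) (map_mx s A) =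
      map_mx s (std_W (map_mx (in_alg (E k)) e1) (map_mx (in_alg (E k)) e2) A).
    by rewrite map_col_mx !map_mxM !gf.
  by rewrite !map_submx.
apply/eqmxP; apply: eqmx_trans eWm (eqmx_trans (std_W_eqmx _ _ eA) _).
by apply: eqmx_sym; apply/eqmxP.
Qed.

Lemma factor_of_det k (q : {poly E k}) : factor_of q ->
  exists c : E k, c != 0 /\
  forall (L : fieldExtType F) (s : 'AHom(E k, L)) (xs ys : seq L),
    map_poly s q = \prod_(x <- xs) ('X - x%:P) ->
    map_poly (in_alg L) chi =
      (\prod_(x <- xs) ('X - x%:P)) * \prod_(y <- ys) ('X - y%:P) ->
    s (d k) = s c ^+ 2 * \prod_(x <- xs) \prod_(y <- ys) (x - y).
Proof.
move=> [A [B [X [Y [Z [pd ->]]]]]].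
have [c c0 ->] := point_data_det pd (hd k); exists c; split=> // L s xs ys exs exy.
rewrite rmorphM rmorphXn /= map_sylvester; congr (_ * _).
have eX : char_poly (map_mx s X) = \prod_(x <- xs) ('X - x%:P) by rewrite -map_char_poly.
have sx : size xs = a.
  by apply/succn_inj; rewrite -(size_prod_XsubC xs id) -eX size_char_poly.
apply: (sylvester_prod_cast sx eX).
apply: (mulfI (monic_neq0 (monic_prod_XsubC xs xpredT id))).
rewrite -exy -{1}eX -!map_char_poly -rmorphM /= -(map_ahom_alg s) -char_poly_L.
by case: pd => ad _; rewrite (adapted_char_poly ad).
Qed.

Theorem closed_points_form : (2%:R : F) != 0 ->
  isometric (oplus_seq [seq transfer1 (d k) | k <- enum 'I_N])
    (pm_form F (('C(2 * j, 2 * i) + 'C(j, i)) %/ 2) (('C(2 * j, 2 * i) - 'C(j, i)) %/ 2)).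
Proof.
move=> n2; have [q hq] := fin_all_exists factor_of_exists.
apply: (@factor_form F i b chi chi_monic chi_size chi_separable N E q).
- by move=> k; have [A [B [X [Y [Z [_ ->]]]]]] := hq k; apply: char_poly_monic.
- by move=> k; have [A [B [X [Y [Z [_ ->]]]]]] := hq k; rewrite size_char_poly ha2.
- move=> k; have [A [B [X [Y [Z [[ad _] ->]]]]]] := hq k.
  by rewrite -char_poly_L (adapted_char_poly ad) dvdp_mulr.
- by move=> k S; apply: factor_of_defined.
- move=> L p zs ezs mp sp; apply: (factor_of_all hq ezs mp); by rewrite sp ha2.
- by move=> k k' s; apply: factor_of_distinct.
- by move=> k; apply: factor_of_det.
- exact: hb2.
- exact: n2.
Qed.

End ClosedPoints.

End Points.

(* For [i = 0] the polynomial [chi] may be inseparable, but then the only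
   balanced point is [W = 0]. *)
Lemma closed_points_form0 (F : fieldType) (j : nat)
    (V : 'I_4 -> 'M[F]_(2 * j, 2 * (2 * j))) (N : nat) (E : 'I_N -> fieldExtType F)
    (W : forall k, 'M[E k]_(2 * (2 * 0), 2 * (2 * j))) (d : forall k, E k) :
  closed_point_system (2 * 0) (2 * j) V E W ->
  (forall k, xi_det_rep (base_change (E k) V) (W k) (d k)) ->
  isometric (oplus_seq [seq transfer1 (d k) | k <- enum 'I_N]) (pm_form F 1 0).
Proof.
move=> [_ hdef hall hdist] hd.
have d1 k : d k = 1.
  by have [C [A [P [D [Q [_ _ _ _ ->]]]]]] := hd k; apply: det_mx00.
(* [W k] has no rows and is thus defined over F, so minimality gives [E k] = F. *)
have full k : 1%VS = fullv :> {vspace E k}.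
  by apply: (hdef k 1%AS); exists (W k); split; [case | rewrite !submx_refl].
have dim1 k : \dim {:E k} = 1%N by rewrite -full dimv1.
have [k0 _] : exists k0, exists s : 'AHom(E k0, F^o),
    (map_mx (fun x => s x) (W k0) == (0 : 'M[F^o]_(2 * (2 * 0), 2 * (2 * j))))%MS.
  apply: hall; split=> [|m]; first by rewrite mxrank0.
  by rewrite (eqmx0P (_ : (0 :&: _)%MS == 0)%MS) ?mxrank0 // cap0mx submx_refl.
have all_k0 k : k = k0.
  (* In degree one 0 is a generator with minimal polynomial ['X]; this yields an embedding into
     [E k0], and irredundancy identifies the two points. *)
  have gen : <<1; (0 : E k)>>%VS = fullv by rewrite (Fadjoin0 1%AS) -full.
  have e0 : map_poly (in_alg (E k)) 'X = minPoly 1 0.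
    by rewrite map_polyX (minPoly_XsubC _) ?mem0v // subr0.
  have [|s _] := @adjoin_ahom F (E k) (E k0) 0 gen 'X 0 e0.
    by rewrite map_polyX rootX.
  apply: (hdist k k0 s); apply/andP; split; apply/row_subP; by case.
have [Q eQ] := oplus_seq_gram (enum 'I_N) (x := fun k => transfer1 (d k))
  (fun k => \matrix_(x < 1, r < projT1 (transfer1 (d k))) coord (vbasis {:E k}) r 1).
apply: (isometric_pm_form (n := 1) (P := Q) (s := predT)) => //.
- rewrite oplus_seq_size big_enum /= (bigD1 k0) //= big1 ?addn0 ?dim1 // => k.
  by rewrite (all_k0 k) eqxx.
- by rewrite card_ord.
apply/matrixP => x y; rewrite eQ summxE big_enum (bigD1 k0) //= big1 ?addr0; last first.
  by move=> k; rewrite (all_k0 k) eqxx.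
rewrite (transfer1_gram (d k0) (fun=> 1)) d1 !mulr1 !mxE ?inE !ord1 eqxx mulr1n.
rewrite /ftrace (eq_bigr (fun=> 1)) ?sumr_const ?card_ord ?dim1 // => r _.
rewrite mul1r coord_free ?eqxx //; exact: basis_free (vbasisP _).
Qed.

Unset Implicit Arguments.

Theorem theorem9p7 (F : fieldType) (i j : nat)
  (hF : (2%:R : F) != 0) (hij : (2 * i < 2 * j)%N)
  (V : 'I_4 -> 'M[F]_(2 * j, 2 * (2 * j)))
  (hV : forall m, \rank (V m) = (2 * j)%N)
  (hgp : gen_pos (2 * i) (2 * j) V)
  (N : nat) (E : 'I_N -> fieldExtType F)
  (W : forall k, 'M[E k]_(2 * (2 * i), 2 * (2 * j)))
  (hW : closed_point_system (2 * i) (2 * j) V E W)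
  (d : forall k, E k)
  (hd : forall k, xi_det_rep (base_change (E k) V) (W k) (d k)) :
  gw_eq (oplus_seq [seq transfer1 (d k) | k <- enum 'I_N])
        (pm_form F (('C(2 * j, 2 * i) + 'C(j, i)) %/ 2)
                   (('C(2 * j, 2 * i) - 'C(j, i)) %/ 2)).
Proof.
apply: isometric_gw_eq; case: i hij hgp W hW hd => [|i] hij hgp W hW hd.
  (* Both binomial coefficients are 1, so the multiplicities compute to 1 and 0. *)
  by rewrite muln0 !bin0; apply: closed_points_form0 hW hd.
have hu : (2 * (2 * j) = 2 * j + 2 * j)%N by rewrite mul2n addnn.
have [e1 [e2 [phi fr]]] := frame_exists hu (proj1 hgp).
apply: (closed_points_form _ hij hV hgp fr hW hd hF) => //.
Qed.
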